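(* Let $a_1,a_2,b_1,b_2,c,t_1,t_2$ be complex numbers with $\Re(c)\neq 0,-1,\dots$, let $k_1,k_2\in\mathbb{N}$ (the value $0$ also being admitted), and let $|x|<1$, $|y|<1$. The following summation formulas hold true, where in the first two $r$ is a nonnegative integer: $$\mathcal{F}^{(1)}_3(a_1,a_2,b_1+r,b_2;c;t_1,t_2,k_1,k_2,x,y)=\sum_{s=0}^{r}\binom{r}{s}\frac{(a_1)_s(-1)^{sk_1}(-t_1)_{sk_1}}{(c)_s}\,x^s\,\mathcal{F}^{(1)}_3(a_1+s,a_2,b_1+s,b_2;c+s;t_1-sk_1,t_2,k_1,k_2,x,y);$$ $$\mathcal{F}^{(1)}_3(a_1,a_2,b_1,b_2+r;c;t_1,t_2,k_1,k_2,x,y)=\sum_{s=0}^{r}\binom{r}{s}\frac{(a_2)_s(-1)^{sk_2}(-t_2)_{sk_2}}{(c)_s}\,y^s\,\mathcal{F}^{(1)}_3(a_1,a_2+s,b_1,b_2+s;c+s;t_1,t_2-sk_2,k_1,k_2,x,y);$$ $$\sum_{r=0}^{\infty}\frac{(a_1)_r}{r!}\,z^r\,\mathcal{F}^{(1)}_3(a_1+r,a_2,b_1,b_2;c;t_1,t_2,k_1,k_2,x,y)=(1-z)^{-a_1}\,\mathcal{F}^{(1)}_3\left(a_1,a_2,b_1,b_2;c;t_1,t_2,k_1,k_2,\frac{x}{1-z},y\right).$$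
   Context: $(z)_n=z(z+1)\cdots(z+n-1)$, $(z)_0=1$, is the Pochhammer symbol. The first discrete Appell function is the function defined by the double series $$\mathcal{F}^{(1)}_3(a_1,a_2,b_1,b_2;c;t_1,t_2,k_1,k_2,x,y)=\sum_{m,n\ge 0}\frac{(a_1)_m(a_2)_n(b_1)_m(b_2)_n(-1)^{mk_1}(-t_1)_{mk_1}(-1)^{nk_2}(-t_2)_{nk_2}}{(c)_{m+n}\,m!\,n!}\,x^m y^n,$$ which the paper asserts to converge absolutely for $|x|<1$, $|y|<1$ and arbitrary complex $t_1,t_2$. In the third formula $z$ is a complex variable, on which the paper states no explicit condition; powers of $1-z$ are those given by the binomial theorem $(1-z)^{-a}=\sum_{j\ge0}\frac{(a)_j}{j!}z^j$.
   Formalization: Absolute convergence of the left-hand F3 (in the third formula, of F3(a1,...;x,y)) is assumed, as it can fail for k1>0 or k2>0; the third formula is for |z|<1, |x/(1-z)|<1, and either |x|+|z|<1 or convergence of the left-hand series. *)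

(* Defs.v *)
From Stdlib Require Export Reals Factorial.
From Coquelicot Require Export Coquelicot.

Local Open Scope C_scope.

Fixpoint Cpochhammer (z : C) (n : nat) : C :=
  match n with
  | O => 1
  | S p => Cpochhammer z p * (z + INR p)
  end.

(* Coquelicot's total sum [Series] exists only for real series. *)
Definition CSeries (u : nat -> C) : C :=
  (Series (fun n => Re (u n)), Series (fun n => Im (u n))).

(* Absolute convergence of the double series of the u m n; the sum of the
   moduli may be taken in any order, here it is taken by rows. *)
Definition abs_convergent2 (u : nat -> nat -> C) : Prop :=
  (forall m, ex_series (fun n => Cmod (u m n))) /\
  ex_series (fun m => Series (fun n => Cmod (u m n))).

(* The sum of the double series when it converges absolutely; like [Series],
   unspecified otherwise. *)
Definition CSeries2 (u : nat -> nat -> C) : C :=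
  CSeries (fun m => CSeries (fun n => u m n)).

Definition F3_term (a1 a2 b1 b2 c t1 t2 : C) (k1 k2 : nat) (x y : C)
    (m n : nat) : C :=
  (Cpochhammer a1 m * Cpochhammer a2 n * Cpochhammer b1 m * Cpochhammer b2 n
   * ((-(1)) ^ (m * k1) * Cpochhammer (- t1) (m * k1))
   * ((-(1)) ^ (n * k2) * Cpochhammer (- t2) (n * k2)))
  / (Cpochhammer c (m + n) * INR (fact m) * INR (fact n))
  * x ^ m * y ^ n.

Definition F3_convergent (a1 a2 b1 b2 c t1 t2 : C) (k1 k2 : nat) (x y : C)
    : Prop :=
  abs_convergent2 (F3_term a1 a2 b1 b2 c t1 t2 k1 k2 x y).

(* The first discrete Appell function. For k1 > 0 the series diverges as soon
   as x <> 0, unless it terminates in m (likewise for k2, y and n), so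
   |x| < 1 and |y| < 1 do not by themselves imply [F3_convergent]. *)
Definition F3 (a1 a2 b1 b2 c t1 t2 : C) (k1 k2 : nat) (x y : C) : C :=
  CSeries2 (F3_term a1 a2 b1 b2 c t1 t2 k1 k2 x y).

(* (1 - z)^(-a) for |z| < 1, by the binomial theorem. *)
Definition one_minus_pow_opp (z a : C) : C :=
  CSeries (fun j => Cpochhammer a j / INR (fact j) * z ^ j).

(* Main.v *)
(* Expanding the Pochhammer symbols, the first two formulas are, coefficient by
   coefficient, the identity (b + r)_m / m! = sum_s binom(r, s) (b + s)_(m - s) / (m - s)!;
   it remains to see that absolute convergence of the left side passes to every
   term on the right whose coefficient is not zero, and this holds because the
   coefficients of those terms are eventually dominated.

   For the third formula sum over n first: F3 becomes M(x) = sum_m (a)_m phi_m x^m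
   with phi_m of size 1 / m! up to subexponential factors (when k1 > 0 convergence
   forces termination). If |x| + |z| < 1 the formula is an exchange of two sums.
   If only the left side is known to converge, its sum is a power series f in z
   and the formula for small z is continued analytically: at w = 1 - z the
   assertion that all Taylor coefficients of f agree with those of
   w^(-a) M(x / w) propagates along discs, by re-expanding f and applying the case
   |x| + |z| < 1 at (x / w, h / w). A path from w = 1 staying in |w| > |x| and inside
   the disc of convergence leads to a point close to the given one, which may lie on
   the boundary circle; Abel's theorem closes the gap. *)
Require Import Defs.
From Stdlib Require Import Lra Lia Classical.
Local Open Scope C_scope.

(** * Complex series *)

(** For positive [k1] or [k2] the double series converges only by terminating, or at a zero
    argument, and this shapes the convergence arguments. Raising [a1] can destroy termination: (a1 +
    r)_m need not vanish where (a1)_m does. It then happens only together with (a1)_r = 0, so the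
    divergent series carries a zero coefficient. For this reason the product (a1)_r (a1 + r)_m is
    kept merged as (a1)_(r+m) in the third formula, and no statement is made about the second factor
    alone. The merged form also makes the coefficients of z^r / r! a sequence whose shift is
    differentiation in z. Power series in z are therefore written as exponential generating
    functions, and the continuation carries all derivatives at once: equality of values at one point
    would not determine the next disc. Convergence in z may be conditional. Only boundedness of the
    terms is drawn from it before the last step, which yields the open disc of radius |z|; the value
    at z itself is left to Abel's theorem. In the first two formulas the second index enters only
    through an arbitrary sequence coupled by (c)_(m+n), so both rest on the same argument. *)

Definition Csummable (u : nat -> C) : Prop := ex_series (fun n => Cmod (u n)).

Lemma Re_sum_n (u : nat -> C) (n : nat) :
  Re (sum_n u n) = sum_n (fun k => Re (u k)) n.
Proof.
  induction n as [|n IH].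
  - now rewrite !sum_O.
  - now rewrite !sum_Sn, <- IH.
Qed.

Lemma Im_sum_n (u : nat -> C) (n : nat) :
  Im (sum_n u n) = sum_n (fun k => Im (u k)) n.
Proof.
  induction n as [|n IH].
  - now rewrite !sum_O.
  - now rewrite !sum_Sn, <- IH.
Qed.

Lemma is_series_C_iff (u : nat -> C) (l : C) :
  is_series u l <->
  is_series (fun n => Re (u n)) (Re l) /\ is_series (fun n => Im (u n)) (Im l).
Proof.
  split.
  - intros H. pose proof (proj1 (filterlim_locally _ _) H) as H'.
    split; apply (proj2 (filterlim_locally _ _)); intros eps;
      generalize (H' eps); apply filter_imp;
      intros n Hn; rewrite <- ?Re_sum_n, <- ?Im_sum_n; apply Hn.
  - intros [H1 H2].
    pose proof (proj1 (filterlim_locally _ _) H1) as H1'.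
    pose proof (proj1 (filterlim_locally _ _) H2) as H2'.
    apply (proj2 (filterlim_locally (U := C_UniformSpace) _ _)). intros eps.
    generalize (filter_and _ _ (H1' eps) (H2' eps)).
    apply filter_imp. intros n [A B].
    rewrite <- Re_sum_n in A. rewrite <- Im_sum_n in B. now split.
Qed.

Lemma CSeries_unique (u : nat -> C) (l : C) : is_series u l -> CSeries u = l.
Proof.
  intros [H1 H2]%is_series_C_iff. unfold CSeries.
  rewrite (is_series_unique _ _ H1), (is_series_unique _ _ H2).
  now destruct l.
Qed.

Lemma CSeries_ext (u v : nat -> C) :
  (forall n, u n = v n) -> CSeries u = CSeries v.
Proof.
  intros H. unfold CSeries.
  f_equal; apply Series_ext; intros n; now rewrite H.
Qed.

Lemma Im_le_Cmod (z : C) : (Rabs (Im z) <= Cmod z)%R.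
Proof. exact (Rle_trans _ _ _ (Rmax_r _ _) (Rmax_Cmod z)). Qed.

Lemma Csummable_Re (u : nat -> C) :
  Csummable u -> ex_series (fun n => Rabs (Re (u n))).
Proof.
  intros H. refine (@ex_series_le R_AbsRing R_CompleteNormedModule _ _ _ H).
  intros n. change norm with Rabs. simpl. rewrite Rabs_Rabsolu. apply re_le_Cmod.
Qed.

Lemma Csummable_Im (u : nat -> C) :
  Csummable u -> ex_series (fun n => Rabs (Im (u n))).
Proof.
  intros H. refine (@ex_series_le R_AbsRing R_CompleteNormedModule _ _ _ H).
  intros n. change norm with Rabs. simpl. rewrite Rabs_Rabsolu. apply Im_le_Cmod.
Qed.

Lemma CSeries_correct (u : nat -> C) : Csummable u -> is_series u (CSeries u).
Proof.
  intros H. apply is_series_C_iff. unfold CSeries; simpl.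
  split; apply Series_correct, ex_series_Rabs;
    [now apply Csummable_Re | now apply Csummable_Im].
Qed.

Lemma ex_series_C_correct (u : nat -> C) : ex_series u -> is_series u (CSeries u).
Proof. intros [l Hl]. now rewrite (CSeries_unique _ _ Hl). Qed.

Lemma ex_series_R_le (u v : nat -> R) :
  (forall n, 0 <= u n <= v n)%R -> ex_series v -> ex_series u.
Proof.
  intros H Hv. refine (@ex_series_le R_AbsRing R_CompleteNormedModule _ _ _ Hv).
  intros n. change norm with Rabs. simpl. rewrite Rabs_pos_eq; apply H.
Qed.

Lemma Csummable_le (u : nat -> C) (v : nat -> R) :
  (forall n, Cmod (u n) <= v n)%R -> ex_series v -> Csummable u.
Proof.
  intros H. apply ex_series_R_le. intros n. split; [apply Cmod_ge_0 | apply H].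
Qed.

Lemma Csummable_ext (u v : nat -> C) :
  (forall n, u n = v n) -> Csummable u -> Csummable v.
Proof.
  intros H. apply ex_series_ext. intros n. now rewrite H.
Qed.

Lemma Csummable_scal (c : C) (u : nat -> C) :
  Csummable u -> Csummable (fun n => c * u n).
Proof.
  intros H. apply (Csummable_le _ (fun n => Cmod c * Cmod (u n)))%R.
  - intros n. rewrite Cmod_mult. apply Rle_refl.
  - exact (ex_series_scal (Cmod c) _ H).
Qed.

Lemma CSeries_scal (c : C) (u : nat -> C) :
  Csummable u -> CSeries (fun n => c * u n) = c * CSeries u.
Proof.
  intros H. apply CSeries_unique.
  exact (is_series_scal c _ _ (CSeries_correct _ H)).
Qed.

Lemma CSeries_scal_r (c : C) (u : nat -> C) :
  Csummable u -> CSeries (fun n => u n * c) = CSeries u * c.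
Proof.
  intros H. rewrite Cmult_comm, <- CSeries_scal by assumption.
  apply CSeries_ext. intros n. apply Cmult_comm.
Qed.

Lemma CSeries_plus (u v : nat -> C) :
  Csummable u -> Csummable v ->
  CSeries (fun n => u n + v n) = CSeries u + CSeries v.
Proof.
  intros Hu Hv. apply CSeries_unique.
  exact (is_series_plus _ _ _ _ (CSeries_correct _ Hu) (CSeries_correct _ Hv)).
Qed.

Lemma is_series_zero_R : is_series (fun _ : nat => 0%R) 0%R.
Proof.
  apply (filterlim_ext (fun _ : nat => 0%R)); [|apply filterlim_const].
  intros n. induction n as [|n IH].
  - now rewrite sum_O.
  - rewrite sum_Sn, <- IH. symmetry. apply Rplus_0_r.
Qed.

Lemma CSeries_zero : CSeries (fun _ => 0) = 0.
Proof.
  unfold CSeries; simpl.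
  now rewrite (is_series_unique _ _ is_series_zero_R).
Qed.

Lemma Cmod_CSeries (u : nat -> C) :
  Csummable u -> (Cmod (CSeries u) <= Series (fun n => Cmod (u n)))%R.
Proof.
  intros H.
  assert (L : is_lim_seq (fun n => Cmod (sum_n u n)) (Cmod (CSeries u))).
  { apply (filterlim_comp _ _ _ (sum_n u) Cmod eventually (locally (CSeries u))).
    - exact (CSeries_correct _ H).
    - apply (filterlim_norm (K := C_AbsRing) (V := C_NormedModule)). }
  refine (is_lim_seq_le _ _ (Finite _) (Finite _) _ L (Series_correct _ H)).
  intros n.
  exact (norm_sum_n_m (K := C_AbsRing) (V := C_NormedModule) u 0 n).
Qed.

Lemma ex_series_shift (s : nat) (u : nat -> R) :
  ex_series u <-> ex_series (fun n => u (n + s)%nat).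
Proof.
  rewrite (ex_series_incr_n u s). split; apply ex_series_ext; intros n; f_equal; lia.
Qed.

Lemma Csummable_shift (s : nat) (u : nat -> C) :
  Csummable u <-> Csummable (fun n => u (n + s)%nat).
Proof. exact (ex_series_shift s (fun n => Cmod (u n))). Qed.

Lemma CSeries_shift (s : nat) (u : nat -> C) :
  Csummable u -> (forall n, (n < s)%nat -> u n = 0) ->
  CSeries u = CSeries (fun n => u (n + s)%nat).
Proof.
  revert u. induction s as [|s IH]; intros u Hu H0.
  - apply CSeries_ext. intros n. f_equal. lia.
  - transitivity (CSeries (fun n => u (S n))).
    + symmetry. apply CSeries_unique.
      apply (is_series_incr_1 u (CSeries u)).
      rewrite H0 by lia.
      change (is_series u (CSeries u + 0)). rewrite Cplus_0_r.
      now apply CSeries_correct.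
    + rewrite IH.
      * apply CSeries_ext. intros n. f_equal. lia.
      * apply (Csummable_shift 1) in Hu. revert Hu. apply Csummable_ext.
        intros n. f_equal. lia.
      * intros n Hn. apply H0. lia.
Qed.

Lemma CSeries_finite (N : nat) (u : nat -> C) :
  (forall n, (N < n)%nat -> u n = 0) -> CSeries u = sum_n u N.
Proof.
  intros H. apply CSeries_unique.
  refine (filterlim_ext_loc (fun _ => sum_n u N) _ _ (filterlim_const _)).
  exists N. intros n Hn. induction Hn as [|n Hn IH]; [reflexivity|].
  rewrite sum_Sn, <- IH, H by lia. symmetry. apply Cplus_0_r.
Qed.

(** * Double series *)

Lemma nonneg_series_bounded (u : nat -> R) (B : R) :
  (forall n, 0 <= u n)%R -> (forall N, sum_n u N <= B)%R ->
  ex_series u /\ (Series u <= B)%R.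
Proof.
  intros H0 HB.
  assert (E : ex_series u).
  { destruct (ex_finite_lim_seq_incr (sum_n u) B) as [l Hl].
    - intros n. rewrite sum_Sn. specialize (H0 (S n)). unfold plus; simpl. lra.
    - exact HB.
    - now exists l. }
  split; [exact E|].
  refine (is_lim_seq_le _ _ (Finite _) (Finite _) HB (Series_correct _ E) _).
  apply is_lim_seq_const.
Qed.

Lemma sum_n_nonneg (u : nat -> R) (n : nat) :
  (forall k, 0 <= u k)%R -> (0 <= sum_n u n)%R.
Proof.
  intros H. induction n as [|n IH].
  - rewrite sum_O. apply H.
  - rewrite sum_Sn. specialize (H (S n)). unfold plus; simpl. lra.
Qed.

Lemma term_le_sum_n (u : nat -> R) (n k : nat) :
  (forall k, 0 <= u k)%R -> (k <= n)%nat -> (u k <= sum_n u n)%R.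
Proof.
  intros H Hk. induction Hk as [|n Hk IH].
  - destruct k as [|k]; [rewrite sum_O; apply Rle_refl|].
    rewrite sum_Sn. pose proof (sum_n_nonneg u k H). unfold plus; simpl. lra.
  - rewrite sum_Sn. specialize (H (S n)). unfold plus; simpl. lra.
Qed.

Lemma sum_n_le_Series (u : nat -> R) (N : nat) :
  (forall n, 0 <= u n)%R -> ex_series u -> (sum_n u N <= Series u)%R.
Proof.
  intros H0 E. apply (is_lim_seq_incr_compare (sum_n u)).
  - exact (Series_correct _ E).
  - intros n. rewrite sum_Sn. specialize (H0 (S n)). unfold plus; simpl. lra.
Qed.

Lemma term_le_Series (u : nat -> R) (N : nat) :
  (forall n, 0 <= u n)%R -> ex_series u -> (u N <= Series u)%R.
Proof.
  intros H0 E. apply Rle_trans with (sum_n u N); [|now apply sum_n_le_Series].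
  now apply term_le_sum_n.
Qed.

Lemma Series_sum_n (u : nat -> nat -> R) (N : nat) :
  (forall n, ex_series (fun m => u m n)) ->
  is_series (fun m => sum_n (u m) N) (sum_n (fun n => Series (fun m => u m n)) N).
Proof.
  intros E. induction N as [|N IH].
  - rewrite sum_O. apply (is_series_ext (fun m => u m O)).
    + intros m. now rewrite sum_O.
    + now apply Series_correct.
  - rewrite sum_Sn.
    apply (is_series_ext (fun m => plus (sum_n (u m) N) (u m (S N)))).
    + intros m. now rewrite sum_Sn.
    + exact (is_series_plus _ _ _ _ IH (Series_correct _ (E (S N)))).
Qed.

(** One half of Tonelli's theorem: a finite sum of columns is the series of the truncated rows,
    hence at most the sum by rows. Used in both directions it gives equality. *)
Lemma Series2_swap_le (u : nat -> nat -> R) :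
  (forall m n, 0 <= u m n)%R -> (forall m, ex_series (u m)) ->
  ex_series (fun m => Series (u m)) ->
  (forall n, ex_series (fun m => u m n)) /\
  ex_series (fun n => Series (fun m => u m n)) /\
  (Series (fun n => Series (fun m => u m n)) <= Series (fun m => Series (u m)))%R.
Proof.
  intros H0 Hr H.
  assert (Hc : forall n, ex_series (fun m => u m n)).
  { intros n. refine (ex_series_R_le _ _ _ H).
    intros m. split; [apply H0 | now apply term_le_Series]. }
  split; [exact Hc|]. apply nonneg_series_bounded.
  - intros n. pose proof (term_le_Series (fun m => u m n) 0 (fun m => H0 m n) (Hc n)).
    specialize (H0 0%nat n). simpl in H1. lra.
  - intros N. rewrite <- (is_series_unique _ _ (Series_sum_n u N Hc)).
    apply Series_le; [|exact H].
    intros m. split; [now apply sum_n_nonneg | now apply sum_n_le_Series].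
Qed.

Lemma Series2_swap_nonneg (u : nat -> nat -> R) :
  (forall m n, 0 <= u m n)%R -> (forall m, ex_series (u m)) ->
  ex_series (fun m => Series (u m)) ->
  Series (fun m => Series (u m)) = Series (fun n => Series (fun m => u m n)).
Proof.
  intros H0 Hr H. destruct (Series2_swap_le u H0 Hr H) as (Hc & H' & Hle).
  apply Rle_antisym; [|exact Hle].
  apply (Series2_swap_le (fun n m => u m n)); [intros; apply H0 | exact Hc | exact H'].
Qed.

Lemma ex_series_Series_le (u v : nat -> nat -> R) :
  (forall m n, 0 <= u m n <= v m n)%R -> (forall m, ex_series (v m)) ->
  ex_series (fun m => Series (v m)) ->
  (forall m, ex_series (u m)) /\ ex_series (fun m => Series (u m)).
Proof.
  intros H Hr Hv.
  assert (Hu : forall m, ex_series (u m)).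
  { intros m. exact (ex_series_R_le _ _ (H m) (Hr m)). }
  split; [exact Hu|]. refine (ex_series_R_le _ _ _ Hv). intros m. split.
  - apply Rle_trans with (u m O); [apply H|].
    apply term_le_Series; [intros n; apply H | apply Hu].
  - apply Series_le; [apply H | apply Hr].
Qed.

Lemma Series2_swap (u : nat -> nat -> R) :
  (forall m, ex_series (fun n => Rabs (u m n))) ->
  ex_series (fun m => Series (fun n => Rabs (u m n))) ->
  Series (fun m => Series (u m)) = Series (fun n => Series (fun m => u m n)).
Proof.
  intros Hr H.
  (* [u = v - |u|] with both [v] and [|u|] nonnegative. *)
  pose (v := fun m n => (u m n + Rabs (u m n))%R).
  assert (Hv : forall m n, (0 <= v m n <= 2 * Rabs (u m n))%R).
  { intros m n. unfold v. pose proof (Rle_abs (u m n)).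
    pose proof (Rle_abs (- u m n)). rewrite Rabs_Ropp in H1. lra. }
  assert (V := ex_series_Series_le v (fun m n => 2 * Rabs (u m n))%R Hv
    (fun m => ex_series_scal 2 (fun n => Rabs (u m n)) (Hr m))).
  destruct V as [Vr V].
  { apply (ex_series_ext (fun m => 2 * Series (fun n => Rabs (u m n)))%R).
    - intros m. symmetry. apply Series_scal_l.
    - exact (ex_series_scal 2 _ H). }
  assert (A0 : forall m n, (0 <= Rabs (u m n))%R) by (intros; apply Rabs_pos).
  assert (V0 : forall m n, (0 <= v m n)%R) by (intros; apply Hv).
  destruct (Series2_swap_le _ A0 Hr H) as (Ac & A & _).
  destruct (Series2_swap_le _ V0 Vr V) as (Vc & V' & _).
  transitivity (Series (fun m => Series (v m))
                - Series (fun m => Series (fun n => Rabs (u m n))))%R.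
  - rewrite <- Series_minus by assumption. apply Series_ext. intros m.
    rewrite <- Series_minus by auto. apply Series_ext. intros n.
    unfold v. ring.
  - rewrite (Series2_swap_nonneg v) by assumption.
    rewrite (Series2_swap_nonneg _ A0) by assumption.
    rewrite <- Series_minus by assumption. apply Series_ext. intros n.
    rewrite <- Series_minus by auto. apply Series_ext. intros m.
    unfold v. ring.
Qed.

Lemma abs_convergent2_swap (u : nat -> nat -> C) :
  abs_convergent2 u -> abs_convergent2 (fun n m => u m n).
Proof.
  intros [Hr H].
  destruct (Series2_swap_le _ (fun m n => Cmod_ge_0 (u m n)) Hr H) as (Hc & H' & _).
  now split.
Qed.

Lemma CSeries2_swap (u : nat -> nat -> C) :
  abs_convergent2 u -> CSeries2 u = CSeries2 (fun n m => u m n).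
Proof.
  intros [Hr H]. unfold CSeries2, CSeries; simpl.
  f_equal; apply Series2_swap.
  - intros m. exact (Csummable_Re _ (Hr m)).
  - refine (proj2 (ex_series_Series_le _ _ _ Hr H)). intros m n.
    split; [apply Rabs_pos | apply re_le_Cmod].
  - intros m. exact (Csummable_Im _ (Hr m)).
  - refine (proj2 (ex_series_Series_le _ _ _ Hr H)). intros m n.
    split; [apply Rabs_pos | apply Im_le_Cmod].
Qed.

Lemma abs_convergent2_le (u v : nat -> nat -> C) :
  (forall m n, Cmod (u m n) <= Cmod (v m n))%R ->
  abs_convergent2 v -> abs_convergent2 u.
Proof.
  intros H [Hr Hv]. apply (ex_series_Series_le _ (fun m n => Cmod (v m n))); auto.
  intros m n. split; [apply Cmod_ge_0 | apply H].
Qed.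

Lemma abs_convergent2_ext (u v : nat -> nat -> C) :
  (forall m n, u m n = v m n) -> abs_convergent2 u -> abs_convergent2 v.
Proof.
  intros H. apply abs_convergent2_le. intros m n. rewrite H. apply Rle_refl.
Qed.

Lemma CSeries2_ext (u v : nat -> nat -> C) :
  (forall m n, u m n = v m n) -> CSeries2 u = CSeries2 v.
Proof.
  intros H. apply CSeries_ext. intros m. apply CSeries_ext. intros n. apply H.
Qed.

Lemma abs_convergent2_row (u : nat -> nat -> C) (m : nat) :
  abs_convergent2 u -> Csummable (u m).
Proof. intros [H _]. apply H. Qed.

Lemma abs_convergent2_sums (u : nat -> nat -> C) :
  abs_convergent2 u -> Csummable (fun m => CSeries (u m)).
Proof.
  intros [Hr H]. refine (Csummable_le _ _ _ H). intros m. exact (Cmod_CSeries (u m) (Hr m)).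
Qed.

Lemma abs_convergent2_scal (c : C) (u : nat -> nat -> C) :
  abs_convergent2 u -> abs_convergent2 (fun m n => c * u m n).
Proof.
  intros [Hr H]. split.
  - intros m. exact (Csummable_scal c _ (Hr m)).
  - apply (ex_series_ext (fun m => Cmod c * Series (fun n => Cmod (u m n)))%R).
    + intros m. rewrite <- Series_scal_l. apply Series_ext. intros n.
      symmetry. apply Cmod_mult.
    + exact (ex_series_scal (Cmod c) _ H).
Qed.

Lemma CSeries2_scal (c : C) (u : nat -> nat -> C) :
  abs_convergent2 u -> CSeries2 (fun m n => c * u m n) = c * CSeries2 u.
Proof.
  intros H. unfold CSeries2. rewrite <- CSeries_scal by exact (abs_convergent2_sums u H).
  apply CSeries_ext. intros m. exact (CSeries_scal c _ (abs_convergent2_row u m H)).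
Qed.

Lemma abs_convergent2_plus (u v : nat -> nat -> C) :
  abs_convergent2 u -> abs_convergent2 v ->
  abs_convergent2 (fun m n => u m n + v m n).
Proof.
  intros [Hur Hu] [Hvr Hv].
  refine (ex_series_Series_le _ (fun m n => Cmod (u m n) + Cmod (v m n))%R _ _ _).
  - intros m n. split; [apply Cmod_ge_0 | apply Cmod_triangle].
  - intros m. exact (ex_series_plus _ _ (Hur m) (Hvr m)).
  - apply (ex_series_ext (fun m => Series (fun n => Cmod (u m n))
                                   + Series (fun n => Cmod (v m n)))%R).
    + intros m. symmetry. now apply Series_plus.
    + exact (ex_series_plus _ _ Hu Hv).
Qed.

Lemma CSeries2_plus (u v : nat -> nat -> C) :
  abs_convergent2 u -> abs_convergent2 v ->
  CSeries2 (fun m n => u m n + v m n) = CSeries2 u + CSeries2 v.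
Proof.
  intros Hu Hv. unfold CSeries2.
  rewrite <- CSeries_plus by (exact (abs_convergent2_sums u Hu)
                              || exact (abs_convergent2_sums v Hv)).
  apply CSeries_ext. intros m.
  exact (CSeries_plus _ _ (abs_convergent2_row u m Hu) (abs_convergent2_row v m Hv)).
Qed.

Lemma CSeries2_sum_n (u : nat -> nat -> nat -> C) (r : nat) :
  (forall s, (s <= r)%nat -> abs_convergent2 (u s)) ->
  abs_convergent2 (fun m n => sum_n (fun s => u s m n) r) /\
  CSeries2 (fun m n => sum_n (fun s => u s m n) r) =
  sum_n (fun s => CSeries2 (u s)) r.
Proof.
  induction r as [|r IH]; intros H.
  - rewrite sum_O. split.
    + apply (abs_convergent2_ext (u O)); [|apply H; lia].
      intros m n. now rewrite sum_O.
    + apply CSeries2_ext. intros m n. now rewrite sum_O.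
  - destruct IH as [IH1 IH2]; [intros s Hs; apply H; lia|].
    assert (E : forall m n, sum_n (fun s => u s m n) r + u (S r) m n
                            = sum_n (fun s => u s m n) (S r)).
    { intros m n. now rewrite sum_Sn. }
    rewrite sum_Sn, <- IH2. split.
    + refine (abs_convergent2_ext _ _ E _).
      apply abs_convergent2_plus; auto.
    + rewrite <- (CSeries2_ext _ _ E). apply CSeries2_plus; auto.
Qed.

Lemma CSeries2_shift (s : nat) (u : nat -> nat -> C) :
  abs_convergent2 u -> (forall m n, (m < s)%nat -> u m n = 0) ->
  CSeries2 u = CSeries2 (fun m n => u (m + s)%nat n).
Proof.
  intros H H0. apply (CSeries_shift s (fun m => CSeries (u m))).
  - now apply abs_convergent2_sums.
  - intros m Hm. rewrite <- CSeries_zero at 1. apply CSeries_ext. intros n. auto.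
Qed.

Lemma abs_convergent2_shift (s : nat) (u : nat -> nat -> C) :
  abs_convergent2 u -> abs_convergent2 (fun m n => u (m + s)%nat n).
Proof.
  intros [Hr H]. split; [intros m; apply Hr|].
  now apply (ex_series_shift s (fun m => Series (fun n => Cmod (u m n)))).
Qed.

Lemma abs_convergent2_geom (K p q : R) (u : nat -> nat -> C) :
  (0 <= p < 1)%R -> (0 <= q < 1)%R ->
  (forall m n, Cmod (u m n) <= K * p ^ m * q ^ n)%R -> abs_convergent2 u.
Proof.
  intros Hp Hq H.
  assert (Gp : ex_series (fun n => p ^ n)%R).
  { exists (/ (1 - p))%R. apply is_series_geom. rewrite Rabs_pos_eq; lra. }
  assert (Gq : ex_series (fun n => q ^ n)%R).
  { exists (/ (1 - q))%R. apply is_series_geom. rewrite Rabs_pos_eq; lra. }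
  refine (ex_series_Series_le _ (fun m n => K * p ^ m * q ^ n)%R _ _ _).
  - intros m n. split; [apply Cmod_ge_0 | apply H].
  - intros m. exact (ex_series_scal (K * p ^ m)%R _ Gq).
  - apply (ex_series_ext (fun m => (K * Series (fun n => q ^ n)) * p ^ m)%R).
    + intros m. rewrite (Series_scal_l (K * p ^ m)%R (fun n => q ^ n)%R).
      simpl. ring.
    + exact (ex_series_scal _ _ Gp).
Qed.

Lemma Csummable_geom (K q : R) (u : nat -> C) :
  (0 <= q < 1)%R -> (forall n, Cmod (u n) <= K * q ^ n)%R -> Csummable u.
Proof.
  intros Hq H. refine (Csummable_le _ _ H (ex_series_scal K (fun n => q ^ n)%R _)).
  exists (/ (1 - q))%R. apply is_series_geom. rewrite Rabs_pos_eq; lra.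
Qed.

(** * Pochhammer symbols and the binomial series *)

Lemma INR_fact_C_neq_0 (n : nat) : RtoC (INR (fact n)) <> 0.
Proof. intros H. apply RtoC_inj in H. exact (INR_fact_neq_0 n H). Qed.

Lemma INR_S_C (n : nat) : RtoC (INR (S n)) = INR n + 1.
Proof. now rewrite S_INR, RtoC_plus. Qed.

Lemma INR_plus_C (m n : nat) : RtoC (INR (m + n)) = INR m + INR n.
Proof. now rewrite plus_INR, RtoC_plus. Qed.

Lemma INR_fact_S_C (n : nat) :
  RtoC (INR (fact (S n))) = (INR n + 1) * INR (fact n).
Proof.
  rewrite <- INR_S_C, <- RtoC_mult, <- mult_INR. reflexivity.
Qed.

Lemma INR_S_C_neq_0 (n : nat) : INR n + 1 <> 0 :> C.
Proof.
  rewrite <- INR_S_C. intros H. apply RtoC_inj in H.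
  exact (not_0_INR (S n) (Nat.neq_succ_0 n) H).
Qed.

Lemma Cmod_INR (n : nat) : Cmod (INR n) = INR n.
Proof. rewrite Cmod_R. apply Rabs_pos_eq, pos_INR. Qed.

Lemma Cmod_pow (z : C) (n : nat) : Cmod (z ^ n) = (Cmod z ^ n)%R.
Proof.
  induction n as [|n IH]; simpl; [apply Cmod_1|]. now rewrite Cmod_mult, IH.
Qed.

Lemma Cpochhammer_add (z : C) (m n : nat) :
  Cpochhammer z (m + n) = Cpochhammer z m * Cpochhammer (z + INR m) n.
Proof.
  induction n as [|n IH].
  - rewrite Nat.add_0_r. simpl. ring.
  - rewrite Nat.add_succ_r. simpl. rewrite IH, INR_plus_C. ring.
Qed.

Lemma Cpochhammer_S_l (z : C) (n : nat) :
  Cpochhammer z (S n) = z * Cpochhammer (z + 1) n.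
Proof.
  change (S n) with (1 + n)%nat. rewrite Cpochhammer_add. simpl.
  rewrite Cplus_0_r. ring.
Qed.

Lemma Cpochhammer_eq_0_le (z : C) (m n : nat) :
  (m <= n)%nat -> Cpochhammer z m = 0 -> Cpochhammer z n = 0.
Proof.
  intros H E. replace n with (m + (n - m))%nat by lia.
  rewrite Cpochhammer_add, E. ring.
Qed.

Lemma Cpochhammer_neq_0 (z : C) (n : nat) :
  (forall k, z + INR k <> 0) -> Cpochhammer z n <> 0.
Proof.
  intros H. induction n as [|n IH]; simpl; [apply C1_nz|].
  now apply Cmult_neq_0.
Qed.

Lemma Cmod_plus_INR_ge (z : C) (n : nat) :
  (INR n - Cmod z <= Cmod (z + INR n))%R.
Proof.
  pose proof (Cmod_triangle (z + INR n) (- z)) as H.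
  replace (z + INR n + - z) with (RtoC (INR n)) in H by ring.
  rewrite Cmod_INR, Cmod_opp in H. lra.
Qed.

Lemma Cmod_plus_INR_le (z : C) (n : nat) :
  (Cmod (z + INR n) <= Cmod z + INR n)%R.
Proof. rewrite <- (Cmod_INR n) at 2. apply Cmod_triangle. Qed.

Lemma INR_unbounded_eventually (B : R) :
  exists N, forall n, (N <= n)%nat -> (B <= INR n)%R.
Proof.
  destruct (INR_unbounded B) as [N HN]. exists N. intros n Hn.
  apply le_INR in Hn. lra.
Qed.

(** * Growth of Pochhammer symbols *)

Lemma Cmod_plus_INR_bounded_below (c : C) :
  (forall n, c + INR n <> 0) ->
  exists d, (0 < d)%R /\ forall n, (d <= Cmod (c + INR n))%R.
Proof.
  intros H.
  assert (F : forall N, exists d, (0 < d)%R /\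
                forall n, (n < N)%nat -> (d <= Cmod (c + INR n))%R).
  { induction N as [|N [d [Hd IH]]].
    - exists 1%R. split; [lra|]. intros; lia.
    - exists (Rmin d (Cmod (c + INR N))). split.
      + apply Rmin_glb_lt; [exact Hd | now apply Cmod_gt_0].
      + intros n Hn. destruct (Nat.eq_dec n N) as [->|E]; [apply Rmin_r|].
        apply Rle_trans with d; [apply Rmin_l | apply IH; lia]. }
  destruct (INR_unbounded_eventually (1 + Cmod c)) as [N HN].
  destruct (F N) as [d [Hd HF]]. exists (Rmin d 1). split.
  - apply Rmin_glb_lt; lra.
  - intros n. destruct (Nat.lt_ge_cases n N) as [L|L].
    + apply Rle_trans with d; [apply Rmin_l | now apply HF].
    + apply Rle_trans with 1%R; [apply Rmin_r|].
      pose proof (Cmod_plus_INR_ge c n). specialize (HN n L). lra.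
Qed.

(** From N on, u grows by a factor no larger than v does; each earlier step costs at most a finite
    factor L. The constant is uniform in t, which is needed when t is the shift n in (c + n)_m. *)
Lemma ratio_bound (T : Type) (u v p q : T -> nat -> R) (K0 : R) :
  (0 <= K0)%R ->
  (forall t n, 0 <= u t n)%R -> (forall t n, 0 <= v t n)%R ->
  (forall t n, 0 <= p t n)%R -> (forall t n, 0 <= q t n)%R ->
  (forall t, u t O <= K0 * v t O)%R ->
  (forall t n, u t (S n) = p t n * u t n)%R ->
  (forall t n, v t (S n) = q t n * v t n)%R ->
  (forall n, exists L, (0 <= L)%R /\ forall t, (p t n <= L * q t n)%R) ->
  (exists N, forall n t, (N <= n)%nat -> (p t n <= q t n)%R) ->
  exists K, (0 <= K)%R /\ forall t n, (u t n <= K * v t n)%R.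
Proof.
  intros HK0 Hu Hv Hp Hq H0 Eu Ev HL [N HN].
  assert (F : exists K, (0 <= K)%R /\
                forall n t, (n <= N)%nat -> (u t n <= K * v t n)%R).
  { clear HN. induction N as [|N [K [HK IH]]].
    - exists K0. split; [exact HK0|]. intros n t Hn.
      replace n with O by lia. apply H0.
    - destruct (HL N) as [L [HL0 HL1]].
      exists (Rmax K (L * K)). split; [apply (Rle_trans _ K); [|apply Rmax_l]; lra|].
      intros n t Hn. destruct (Nat.eq_dec n (S N)) as [->|E].
      + apply Rle_trans with (L * K * v t (S N))%R.
        * rewrite Eu, Ev. specialize (IH N t (Nat.le_refl N)). specialize (HL1 t).
          apply Rle_trans with (p t N * (K * v t N))%R.
          { apply Rmult_le_compat_l; auto. }
          replace (L * K * (q t N * v t N))%R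
            with (L * q t N * (K * v t N))%R by ring.
          apply Rmult_le_compat_r; [apply Rmult_le_pos; auto | exact HL1].
        * apply Rmult_le_compat_r; [apply Hv | apply Rmax_r].
      + apply Rle_trans with (K * v t n)%R; [apply IH; lia|].
        apply Rmult_le_compat_r; [apply Hv | apply Rmax_l]. }
  destruct F as [K [HK F]]. exists K. split; [exact HK|]. intros t n.
  destruct (Nat.le_ge_cases n N) as [L|L]; [now apply F|].
  induction L as [|n L IH]; [now apply F|].
  rewrite Eu, Ev. apply Rle_trans with (p t n * (K * v t n))%R.
  - apply Rmult_le_compat_l; auto.
  - replace (K * (q t n * v t n))%R with (q t n * (K * v t n))%R by ring.
    apply Rmult_le_compat_r; [apply Rmult_le_pos; auto | now apply HN].
Qed.

(** The quotient |a + n| / (n + 1) of consecutive ratios tends to 1, so it drops below l once n (l -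
    1) >= |a|. *)
Lemma Cpochhammer_upper (a : C) (l : R) :
  (1 < l)%R ->
  exists K, (0 <= K)%R /\
    forall n, (Cmod (Cpochhammer a n) <= K * (l ^ n * INR (fact n)))%R.
Proof.
  intros Hl.
  destruct (ratio_bound unit (fun _ n => Cmod (Cpochhammer a n))
    (fun _ n => l ^ n * INR (fact n))%R (fun _ n => Cmod (a + INR n))
    (fun _ n => l * INR (S n))%R 1) as [K [HK H]].
  - lra.
  - intros _ n. apply Cmod_ge_0.
  - intros _ n. apply Rmult_le_pos; [apply pow_le; lra | apply pos_INR].
  - intros _ n. apply Cmod_ge_0.
  - intros _ n. apply Rmult_le_pos; [lra | apply pos_INR].
  - intros _. simpl. rewrite Cmod_1. lra.
  - intros _ n. simpl. rewrite Cmod_mult. apply Rmult_comm.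
  - intros _ n. change (fact (S n)) with (S n * fact n)%nat.
    rewrite mult_INR. simpl pow. ring.
  - intros n. pose proof (lt_0_INR (S n) (Nat.lt_0_succ n)) as P.
    exists (Cmod (a + INR n) / (l * INR (S n)))%R. split.
    + apply Rmult_le_pos; [apply Cmod_ge_0|].
      left. apply Rinv_0_lt_compat. nra.
    + intros _. right. field. split; lra.
  - destruct (INR_unbounded_eventually (Cmod a / (l - 1))) as [N HN].
    exists N. intros n _ Hn. specialize (HN n Hn).
    apply Rle_trans with (1 := Cmod_plus_INR_le a n).
    apply (Rmult_le_compat_r (l - 1)) in HN; [|lra].
    unfold Rdiv in HN. rewrite Rmult_assoc, Rinv_l, Rmult_1_r in HN by lra.
    rewrite S_INR. nra.
  - exists K. split; [exact HK|]. intros n. exact (H tt n).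
Qed.

(** Uniformity in n comes from two bounds: the numbers c + n stay at a positive distance d from 0,
    which handles small m, and |c + n + m| >= m - |c| handles large m. *)
Lemma Cpochhammer_lower (c : C) (l : R) :
  (1 < l)%R -> (forall n, c + INR n <> 0) ->
  exists K, (0 <= K)%R /\
    forall n m, (INR (fact m) <= K * (l ^ m * Cmod (Cpochhammer (c + INR n) m)))%R.
Proof.
  intros Hl Hc. destruct (Cmod_plus_INR_bounded_below c Hc) as [d [Hd Hcd]].
  assert (Hcn : forall n m, c + INR n + INR m = c + INR (n + m)).
  { intros n m. rewrite INR_plus_C. ring. }
  destruct (ratio_bound nat (fun _ m => INR (fact m))
    (fun n m => l ^ m * Cmod (Cpochhammer (c + INR n) m))%R
    (fun _ m => INR (S m)) (fun n m => l * Cmod (c + INR n + INR m))%R 1)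
    as [K [HK H]].
  - lra.
  - intros _ m. apply pos_INR.
  - intros n m. apply Rmult_le_pos; [apply pow_le; lra | apply Cmod_ge_0].
  - intros _ m. apply pos_INR.
  - intros n m. apply Rmult_le_pos; [lra | apply Cmod_ge_0].
  - intros n. simpl. rewrite Cmod_1. lra.
  - intros _ m. now rewrite <- mult_INR.
  - intros n m. simpl. rewrite Cmod_mult. ring.
  - intros m. exists (INR (S m) / (l * d))%R. pose proof (pos_INR (S m)) as P.
    assert (0 < l * d)%R by nra.
    assert (Q : (0 <= INR (S m) / (l * d))%R).
    { apply Rmult_le_pos; [exact P|]. left. now apply Rinv_0_lt_compat. }
    split; [exact Q|]. intros n. rewrite Hcn.
    apply Rle_trans with (INR (S m) / (l * d) * (l * d))%R.
    + right. field. split; lra.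
    + apply Rmult_le_compat_l; [exact Q|]. apply Rmult_le_compat_l; [lra | apply Hcd].
  - destruct (INR_unbounded_eventually ((1 + l * Cmod c) / (l - 1))) as [N HN].
    exists N. intros m n Hm. specialize (HN m Hm). rewrite Hcn.
    apply (Rmult_le_compat_r (l - 1)) in HN; [|lra].
    unfold Rdiv in HN. rewrite Rmult_assoc, Rinv_l, Rmult_1_r in HN by lra.
    pose proof (Cmod_plus_INR_ge c (n + m)) as G.
    assert (INR m <= INR (n + m))%R by (apply le_INR; lia).
    rewrite S_INR.
    apply Rle_trans with (l * (INR m - Cmod c))%R; [nra|].
    apply Rmult_le_compat_l; lra.
  - exists K. split; [exact HK|]. intros n m. exact (H n m).
Qed.

Lemma binomial_term_summable (a z : C) :
  (Cmod z < 1)%R -> Csummable (fun j => Cpochhammer a j / INR (fact j) * z ^ j).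
Proof.
  intros Hz. pose proof (Cmod_ge_0 z) as Hz0.
  (* The rate l = 2 / (1 + |z|) satisfies l > 1 and l |z| < 1. *)
  destruct (Cpochhammer_upper a (2 / (1 + Cmod z))) as [K [HK H]].
  { apply (Rmult_lt_reg_r (1 + Cmod z)); [lra|].
    unfold Rdiv. rewrite Rmult_assoc, Rinv_l by lra. lra. }
  apply (Csummable_geom K (2 / (1 + Cmod z) * Cmod z)).
  - split.
    + apply Rmult_le_pos; [|lra]. apply Rmult_le_pos; [lra|].
      left. apply Rinv_0_lt_compat. lra.
    + apply (Rmult_lt_reg_r (1 + Cmod z)); [lra|].
      replace (2 / (1 + Cmod z) * Cmod z * (1 + Cmod z))%R with (2 * Cmod z)%R
        by (field; lra). lra.
  - intros n. rewrite Cmod_mult, Cmod_div, Cmod_pow, Cmod_INR by apply INR_fact_C_neq_0.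
    rewrite Rpow_mult_distr, <- Rmult_assoc.
    apply Rmult_le_compat_r; [now apply pow_le|].
    pose proof (INR_fact_lt_0 n).
    apply (Rmult_le_reg_r (INR (fact n))); [assumption|].
    unfold Rdiv at 1. rewrite Rmult_assoc, Rinv_l, Rmult_1_r by lra.
    specialize (H n). lra.
Qed.

(** Coefficientwise, multiplication by 1 - z gives (a + 1)_j / j! - (a + 1)_(j-1) / (j - 1)! = (a)_j
    / j!; the series [v] is z times [q], delayed by one index. *)
Lemma one_minus_pow_opp_succ (z a : C) :
  (Cmod z < 1)%R ->
  one_minus_pow_opp z (a + 1) * (1 - z) = one_minus_pow_opp z a.
Proof.
  intros Hz. unfold one_minus_pow_opp.
  pose (q := fun j => Cpochhammer (a + 1) j / INR (fact j) * z ^ j).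
  pose (v := fun j => match j with O => RtoC 0 | S i => z * q i end).
  assert (Sq : Csummable q) by now apply binomial_term_summable.
  assert (Sv : Csummable v).
  { apply (Csummable_shift 1). apply (Csummable_ext (fun j => z * q j)).
    - intros n. now rewrite Nat.add_1_r.
    - now apply Csummable_scal. }
  assert (Ev : CSeries v = z * CSeries q).
  { rewrite (CSeries_shift 1 v Sv).
    - rewrite <- CSeries_scal by exact Sq.
      apply CSeries_ext. intros n. now rewrite Nat.add_1_r.
    - intros n Hn. now replace n with O by lia. }
  fold q. transitivity (CSeries q + - (1) * CSeries v).
  - rewrite Ev. ring.
  - rewrite <- CSeries_scal, <- CSeries_plus by
      (assumption || now apply Csummable_scal).
    apply CSeries_ext. intros [|n]; unfold q, v.
    + simpl. ring.
    + unfold q. rewrite (Cpochhammer_S_l a), INR_fact_S_C.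
      change (Cpochhammer (a + 1) (S n))
        with (Cpochhammer (a + 1) n * (a + 1 + INR n)).
      simpl Cpow. field. split; [apply INR_fact_C_neq_0 | apply INR_S_C_neq_0].
Qed.

Lemma one_minus_pow_opp_add (z a : C) (n : nat) :
  (Cmod z < 1)%R ->
  one_minus_pow_opp z (a + INR n) * (1 - z) ^ n = one_minus_pow_opp z a.
Proof.
  intros Hz. induction n as [|n IH].
  - simpl. rewrite Cplus_0_r. ring.
  - rewrite INR_S_C, Cplus_assoc. simpl.
    rewrite Cmult_assoc, one_minus_pow_opp_succ by exact Hz. exact IH.
Qed.

(** * Pascal's triangle and the binomial theorem *)

Lemma sum_n_pascal (f : nat -> C) (r : nat) :
  sum_n (fun s => Binomial.C r s * f s) r
  + sum_n (fun s => Binomial.C r s * f (S s)) r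
  = sum_n (fun s => Binomial.C (S r) s * f s) (S r).
Proof.
  assert (C0 : forall n, Binomial.C n 0 = 1%R).
  { intros n. unfold Binomial.C. rewrite Nat.sub_0_r. simpl.
    field. apply INR_fact_neq_0. }
  assert (Cn : forall n, Binomial.C n n = 1%R).
  { intros n. unfold Binomial.C. rewrite Nat.sub_diag. simpl.
    field. apply INR_fact_neq_0. }
  (* Subtraction is truncated, so [Binomial.C r (S r)] is not zero and Pascal's rule stops at the
     edge. The induction therefore runs over partial sums, with the boundary term kept explicit. *)
  assert (P : forall q, (q <= r)%nat ->
    sum_n (fun s => Binomial.C r s * f s) q
    + sum_n (fun s => Binomial.C r s * f (S s)) q
    = sum_n (fun s => Binomial.C (S r) s * f s) q + Binomial.C r q * f (S q)).
  { induction q as [|q IH]; intros Hq.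
    - rewrite !sum_O, !C0. ring.
    - rewrite !sum_Sn. unfold plus; simpl.
      transitivity (sum_n (fun s => Binomial.C r s * f s) q
        + sum_n (fun s => Binomial.C r s * f (S s)) q
        + Binomial.C r (S q) * (f (S q) + f (S (S q)))); [ring|].
      rewrite IH, <- (pascal r q), RtoC_plus by lia. ring. }
  rewrite P by lia. rewrite sum_Sn, !Cn. reflexivity.
Qed.

(** Unfolding the recurrence walks from (r, 0) down to q = 0, and the binomial coefficient counts
    the paths ending at (0, s). Requiring it only for q + s < r suits exponents n - q - s with
    truncated subtraction. *)
Lemma sum_n_binomial_recurrence (r : nat) (X : nat -> nat -> C) :
  (forall q s, (q + s < r)%nat -> X (S q) s = X q s + X q (S s)) ->
  X r O = sum_n (fun s => Binomial.C r s * X O s) r.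
Proof.
  revert X. induction r as [|r IH]; intros X H.
  - rewrite sum_O. unfold Binomial.C. simpl.
    replace (1 / (1 * 1))%R with 1%R by field. ring.
  - rewrite H, <- sum_n_pascal, (IH X), (IH (fun q s => X q (S s))) by
      (try intros; try apply H; lia). reflexivity.
Qed.

Lemma Cpow_binomial_fact (x y : C) (n : nat) :
  (x + y) ^ n / INR (fact n) =
  sum_n (fun k => x ^ (n - k) * y ^ k / (INR (fact (n - k)) * INR (fact k))) n.
Proof.
  transitivity (/ INR (fact n) *
    sum_n (fun k => Binomial.C n k * (x ^ (n - k) * y ^ k)) n).
  - rewrite (sum_n_ext _
      (fun s => Binomial.C n s * ((x + y) ^ 0 * (x ^ (n - 0 - s) * y ^ s)))).
    + rewrite <- (sum_n_binomial_recurrence n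
        (fun q s => (x + y) ^ q * (x ^ (n - q - s) * y ^ s))).
      * rewrite Nat.sub_diag. simpl. unfold Cdiv. ring.
      * intros q s H. replace (n - q - s)%nat with (S (n - S q - s)) by lia.
        replace (n - q - S s)%nat with (n - S q - s)%nat by lia. simpl. ring.
    + intros k. rewrite Nat.sub_0_r. simpl. ring.
  - rewrite <- (sum_n_mult_l (K := C_Ring)). apply sum_n_ext_loc. intros k Hk.
    unfold mult, Binomial.C; simpl.
    rewrite RtoC_div, RtoC_mult by
      (apply Rmult_integral_contrapositive_currified; apply INR_fact_neq_0).
    field. repeat split; apply INR_fact_C_neq_0.
Qed.

(** * Taylor expansion of exponential generating functions *)

(** The left side is a single nonnegative term in the expansion of (x + y)^(m+k) = 1. *)
Lemma C_le_one (m k : nat) (x y : R) :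
  (0 <= x)%R -> (0 <= y)%R -> (x + y = 1)%R ->
  (INR (fact (m + k)) / (INR (fact m) * INR (fact k)) * x ^ m * y ^ k <= 1)%R.
Proof.
  intros Hx Hy H. rewrite <- (pow1 (m + k)), <- H, binomial, <- sum_n_Reals.
  pose (f := fun i => (Binomial.C (m + k) i * x ^ i * y ^ (m + k - i))%R).
  assert (F : forall i, (0 <= f i)%R).
  { intros i. unfold f, Binomial.C.
    repeat apply Rmult_le_pos; try apply pow_le; try assumption; try apply pos_INR.
    left. apply Rinv_0_lt_compat, Rmult_lt_0_compat; apply INR_fact_lt_0. }
  pose proof (term_le_sum_n f (m + k) m F ltac:(lia)) as G. unfold f at 1, Binomial.C in G.
  replace (m + k - m)%nat with k in G by lia. exact G.
Qed.

Lemma multinomial_geometric (x y : R) :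
  (0 <= x)%R -> (0 <= y)%R -> (x + y < 1)%R ->
  exists p q, (0 <= p < 1)%R /\ (0 <= q < 1)%R /\ forall m k,
    (INR (fact (m + k)) / (INR (fact m) * INR (fact k)) * x ^ m * y ^ k
     <= p ^ m * q ^ k)%R.
Proof.
  (* Adding e to both x and y makes their sum 1, so [C_le_one] applies; the slack becomes the ratios
     x / (x + e) and y / (y + e). *)
  intros Hx Hy H. pose (e := ((1 - x - y) / 2)%R).
  assert (He : (0 < e)%R) by (unfold e; lra).
  assert (Q : forall t, (0 <= t)%R -> (0 <= t / (t + e) < 1)%R).
  { intros t Ht. split.
    - apply Rmult_le_pos; [exact Ht|]. left. apply Rinv_0_lt_compat. lra.
    - apply (Rmult_lt_reg_r (t + e)); [lra|].
      unfold Rdiv. rewrite Rmult_assoc, Rinv_l by lra. lra. }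
  exists (x / (x + e))%R, (y / (y + e))%R. split; [now apply Q|]. split; [now apply Q|].
  intros m k.
  assert (E : forall t n, (0 <= t)%R -> (t ^ n = (t / (t + e)) ^ n * (t + e) ^ n)%R).
  { intros t n Ht. rewrite <- Rpow_mult_distr. f_equal. field. lra. }
  rewrite (E x m Hx), (E y k Hy).
  assert (B := C_le_one m k (x + e) (y + e) ltac:(lra) ltac:(lra)
    ltac:(unfold e; lra)).
  set (P := ((x / (x + e)) ^ m)%R). set (S := ((y / (y + e)) ^ k)%R).
  assert (0 <= P * S)%R by
    (apply Rmult_le_pos; apply pow_le; apply Q; assumption).
  match goal with |- (?L <= _)%R => replace L with
    (P * S * (INR (fact (m + k)) / (INR (fact m) * INR (fact k))
      * (x + e) ^ m * (y + e) ^ k))%R by ring end.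
  rewrite <- (Rmult_1_r (P * S)) at 2. now apply Rmult_le_compat_l.
Qed.

(** Delaying row k by k places turns the diagonals m + k = N into columns, which are finite; the
    claim becomes an exchange of sums. *)
Lemma CSeries2_diagonal (v : nat -> nat -> C) :
  abs_convergent2 v ->
  CSeries2 (fun k m => v m k) =
  CSeries (fun N => sum_n (fun k => v (N - k)%nat k) N).
Proof.
  intros Hv. apply abs_convergent2_swap in Hv.
  pose (w := fun k N => if Nat.leb k N then v (N - k)%nat k else 0).
  assert (w0 : forall k N, (N < k)%nat -> w k N = 0).
  { intros k N H. unfold w. now rewrite (proj2 (Nat.leb_gt k N) H). }
  assert (w1 : forall k m, w k (m + k)%nat = v m k).
  { intros k m. unfold w. rewrite (proj2 (Nat.leb_le k (m + k))) by lia.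
    f_equal. lia. }
  destruct Hv as [Hr H].
  assert (Wr : forall k, Csummable (w k)).
  { intros k. apply (Csummable_shift k), (Csummable_ext (fun m => v m k)).
    - intros m. symmetry. apply w1.
    - apply Hr. }
  assert (W : abs_convergent2 w).
  { split; [exact Wr|]. revert H. apply ex_series_ext. intros k.
    (* The real series of moduli is read as the real part of a complex one, so that [CSeries_shift]
       can remove its leading zeros. *)
    transitivity (Re (CSeries (fun N => RtoC (Cmod (w k N))))); [|reflexivity].
    rewrite (CSeries_shift k).
    - simpl. apply Series_ext. intros m. now rewrite w1.
    - generalize (Wr k). apply ex_series_ext. intros N.
      rewrite Cmod_R, Rabs_pos_eq; [reflexivity | apply Cmod_ge_0].
    - intros N HN. now rewrite w0, Cmod_0. }
  transitivity (CSeries2 w).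
  - apply CSeries_ext. intros k. etransitivity;
      [|symmetry; exact (CSeries_shift k (w k) (Wr k) (w0 k))].
    apply CSeries_ext. intros m. now rewrite w1.
  - rewrite CSeries2_swap by exact W. apply CSeries_ext. intros N.
    rewrite (CSeries_finite N).
    + apply sum_n_ext_loc. intros k Hk. unfold w.
      now rewrite (proj2 (Nat.leb_le k N)) by lia.
    + intros k Hk. now apply w0.
Qed.

(* Exponential generating functions: the coefficients [fun n => d (n + k)]
   belong to the k-th derivative, so [egf_taylor] is Taylor's formula. *)
Definition egf (d : nat -> C) (z : C) : C :=
  CSeries (fun n => d n / INR (fact n) * z ^ n).

Definition egf_bounded (d : nat -> C) (rho : R) : Prop :=
  exists K, forall n, (Cmod (d n) / INR (fact n) * rho ^ n <= K)%R.

(** Differentiation brings in the factor (n + k)! / n! = k! (k + 1)_n / n!, which grows more slowly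
    than (rho / q)^n. This is the reason for the loss of radius. *)
Lemma egf_bounded_shift (d : nat -> C) (rho q : R) (k : nat) :
  (0 < q < rho)%R -> egf_bounded d rho -> egf_bounded (fun n => d (n + k)%nat) q.
Proof.
  intros Hq [K HK].
  assert (Hl : (1 < rho / q)%R).
  { apply (Rmult_lt_reg_r q); [lra|]. unfold Rdiv.
    rewrite Rmult_assoc, Rinv_l by lra. lra. }
  destruct (Cpochhammer_upper (1 + INR k) (rho / q) Hl) as [L [HL H]].
  assert (F : forall n, RtoC (INR (fact (n + k)))
                        = INR (fact k) * Cpochhammer (1 + INR k) n).
  { induction n as [|n IH]; [simpl; ring|].
    rewrite Nat.add_succ_l, INR_fact_S_C, IH, INR_plus_C. simpl. ring. }
  assert (K0 : (0 <= K)%R).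
  { apply Rle_trans with (2 := HK O). simpl. unfold Rdiv. rewrite Rinv_1, !Rmult_1_r.
    apply Cmod_ge_0. }
  exists (K * (INR (fact k) * L) / rho ^ k)%R. intros n.
  pose proof (INR_fact_lt_0 n) as Pn. pose proof (INR_fact_lt_0 k) as Pk.
  pose proof (INR_fact_lt_0 (n + k)) as Pnk.
  assert (Pr : (0 < rho ^ k)%R) by (apply pow_lt; lra).
  assert (Prn : (0 < rho ^ n)%R) by (apply pow_lt; lra).
  assert (Pqn : (0 < q ^ n)%R) by (apply pow_lt; lra).
  assert (G : (INR (fact (n + k)) * q ^ n <= INR (fact k) * L * rho ^ n * INR (fact n))%R).
  { rewrite <- (Cmod_INR (fact (n + k))), F, Cmod_mult, Cmod_INR.
    specialize (H n).
    apply Rle_trans with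
      (INR (fact k) * (L * ((rho / q) ^ n * INR (fact n))) * q ^ n)%R.
    - apply Rmult_le_compat_r; [lra|]. apply Rmult_le_compat_l; lra.
    - right. unfold Rdiv. rewrite Rpow_mult_distr, pow_inv. field. lra. }
  specialize (HK (n + k)%nat). rewrite pow_add in HK.
  apply (Rmult_le_reg_r (rho ^ n * INR (fact n) * (INR (fact (n + k)) * rho ^ k))%R).
  { apply Rmult_lt_0_compat; apply Rmult_lt_0_compat; assumption. }
  match goal with |- (?A <= ?B)%R =>
    replace A with (Cmod (d (n + k)%nat) / INR (fact (n + k)) * (rho ^ n * rho ^ k)
      * (INR (fact (n + k)) * (INR (fact (n + k)) * q ^ n)))%R by (field; lra);
    replace B with (K * (INR (fact (n + k))
      * (INR (fact k) * L * rho ^ n * INR (fact n))))%R by (field; lra) end.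
  apply Rmult_le_compat.
  - apply Rmult_le_pos; [|nra]. apply Rmult_le_pos; [apply Cmod_ge_0|].
    left. now apply Rinv_0_lt_compat.
  - apply Rmult_le_pos; [lra|]. apply Rmult_le_pos; lra.
  - exact HK.
  - apply Rmult_le_compat_l; [lra | exact G].
Qed.

Lemma egf_summable (d : nat -> C) (rho : R) (z : C) :
  (0 < rho)%R -> egf_bounded d rho -> (Cmod z < rho)%R ->
  Csummable (fun n => d n / INR (fact n) * z ^ n).
Proof.
  intros Hrho [K HK] Hz. apply (Csummable_geom K (Cmod z / rho)).
  - split.
    + apply Rmult_le_pos; [apply Cmod_ge_0|]. left. now apply Rinv_0_lt_compat.
    + apply (Rmult_lt_reg_r rho); [exact Hrho|].
      unfold Rdiv. rewrite Rmult_assoc, Rinv_l by lra. lra.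
  - intros n. rewrite Cmod_mult, Cmod_div, Cmod_pow, Cmod_INR by apply INR_fact_C_neq_0.
    apply Rle_trans with (Cmod (d n) / INR (fact n) * rho ^ n * (Cmod z / rho) ^ n)%R.
    + right. unfold Rdiv. rewrite Rpow_mult_distr, pow_inv. field.
      split; [apply pow_nonzero; lra | apply INR_fact_neq_0].
    + apply Rmult_le_compat_r; [|exact (HK n)].
      apply pow_le, Rmult_le_pos; [apply Cmod_ge_0|].
      left. now apply Rinv_0_lt_compat.
Qed.

Lemma egf_shift_summable (d : nat -> C) (rho : R) (k : nat) (z : C) :
  (0 < rho)%R -> egf_bounded d rho -> (Cmod z < rho)%R ->
  Csummable (fun n => d (n + k)%nat / INR (fact n) * z ^ n).
Proof.
  intros Hrho H Hz. pose proof (Cmod_ge_0 z).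
  apply (egf_summable _ ((Cmod z + rho) / 2)); [lra| |lra].
  apply (egf_bounded_shift d rho); [lra | exact H].
Qed.

(** Expand (z + h)^n and regroup by powers of h. The double series converges absolutely by
    [multinomial_geometric] at |z| / rho and |h| / rho, whose sum is below 1. *)
Lemma egf_taylor (d : nat -> C) (rho : R) (z h : C) :
  (0 < rho)%R -> egf_bounded d rho -> (Cmod z + Cmod h < rho)%R ->
  egf d (z + h) = egf (fun k => egf (fun n => d (n + k)%nat) z) h.
Proof.
  intros Hrho [K HK] Hzh.
  assert (Q : forall t, (0 <= t)%R -> (0 <= t / rho)%R).
  { intros t Ht. apply Rmult_le_pos; [exact Ht|]. left. now apply Rinv_0_lt_compat. }
  destruct (multinomial_geometric (Cmod z / rho) (Cmod h / rho))
    as (p & q & Hp & Hq & H); try (apply Q, Cmod_ge_0).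
  { apply (Rmult_lt_reg_r rho); [exact Hrho|].
    replace ((Cmod z / rho + Cmod h / rho) * rho)%R with (Cmod z + Cmod h)%R
      by (field; lra). lra. }
  pose (v := fun m k => d (m + k)%nat
    * (z ^ m * h ^ k / (INR (fact m) * INR (fact k)))).
  assert (V : abs_convergent2 v).
  { apply (abs_convergent2_geom K p q); try assumption. intros m k. unfold v.
    rewrite Cmod_mult, Cmod_div, !Cmod_mult, !Cmod_pow, !Cmod_INR by
      (apply Cmult_neq_0; apply INR_fact_C_neq_0).
    specialize (H m k). specialize (HK (m + k)%nat).
    pose proof (INR_fact_lt_0 m). pose proof (INR_fact_lt_0 k).
    pose proof (INR_fact_lt_0 (m + k)).
    replace (Cmod (d (m + k)%nat)
      * (Cmod z ^ m * Cmod h ^ k / (INR (fact m) * INR (fact k))))%R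
    with ((Cmod (d (m + k)%nat) / INR (fact (m + k)) * rho ^ (m + k))
      * (INR (fact (m + k)) / (INR (fact m) * INR (fact k))
         * (Cmod z / rho) ^ m * (Cmod h / rho) ^ k))%R.
    - rewrite (Rmult_assoc K). apply Rmult_le_compat; try assumption.
      + apply Rmult_le_pos; [|apply pow_le; lra].
        apply Rmult_le_pos; [apply Cmod_ge_0|].
        left. now apply Rinv_0_lt_compat.
      + apply Rmult_le_pos; [apply Rmult_le_pos|]; try (apply pow_le, Q, Cmod_ge_0).
        apply Rmult_le_pos; [lra|]. left. apply Rinv_0_lt_compat. nra.
    - unfold Rdiv. rewrite !Rpow_mult_distr, pow_add, !pow_inv.
      field. repeat split; try lra; apply pow_nonzero; lra. }
  transitivity (CSeries2 (fun k m => v m k)).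
  - rewrite CSeries2_diagonal by exact V. apply CSeries_ext. intros n.
    transitivity (d n * ((z + h) ^ n / INR (fact n))).
    { unfold Cdiv. ring. }
    rewrite Cpow_binomial_fact, <- (sum_n_mult_l (K := C_Ring)).
    apply sum_n_ext_loc. intros k Hk. unfold v, mult; simpl.
    now replace (n - k + k)%nat with n by lia.
  - apply CSeries_ext. intros k. unfold egf.
    assert (Sk : Csummable (fun n => d (n + k)%nat / INR (fact n) * z ^ n)).
    { pose proof (Cmod_ge_0 h).
      apply (egf_shift_summable d rho); [exact Hrho | now exists K | lra]. }
    transitivity (CSeries (fun n => d (n + k)%nat / INR (fact n) * z ^ n)
      * (h ^ k / INR (fact k))); [|unfold Cdiv; ring].
    rewrite <- CSeries_scal_r by exact Sk.
    apply CSeries_ext. intros m. unfold v. field.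
    split; apply INR_fact_C_neq_0.
Qed.

(** * The single series in m *)

Lemma egf_0 (d : nat -> C) : egf d 0 = d O.
Proof.
  unfold egf. rewrite (CSeries_finite 0).
  - rewrite sum_O. simpl. field.
  - intros [|n] Hn; [lia|]. simpl. ring.
Qed.

(** Each term is a difference of two partial sums, and these are bounded. Thus conditional
    convergence at z already gives the whole radius |z|. *)
Lemma egf_bounded_of_ex_series (d : nat -> C) (z : C) :
  ex_series (fun n => d n / INR (fact n) * z ^ n) -> egf_bounded d (Cmod z).
Proof.
  intros H. destruct (filterlim_bounded _ H) as [M HM].
  change norm with Cmod in HM.
  exists (M + M)%R. intros n.
  replace (Cmod (d n) / INR (fact n) * Cmod z ^ n)%R
    with (Cmod (d n / INR (fact n) * z ^ n)).
  - pose proof (Rle_trans _ _ _ (Cmod_ge_0 _) (HM O)) as M0.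
    destruct n as [|n].
    + specialize (HM O). rewrite sum_O in HM. lra.
    + pose proof (HM (S n)) as H1. specialize (HM n). rewrite sum_Sn in H1.
      set (t := d (S n) / INR (fact (S n)) * z ^ S n) in *.
      set (s := sum_n _ n) in *. change (Cmod (s + t) <= M)%R in H1.
      pose proof (Cmod_triangle (s + t) (- s)) as T.
      replace (s + t + - s) with t in T by ring. rewrite Cmod_opp in T. lra.
  - now rewrite Cmod_mult, Cmod_div, Cmod_pow, Cmod_INR by apply INR_fact_C_neq_0.
Qed.

Lemma Cmod_one_minus_ge (z : C) : (1 - Cmod z <= Cmod (1 - z))%R.
Proof.
  pose proof (Cmod_triangle (1 - z) z) as H.
  replace (1 - z + z) with (RtoC 1) in H by ring. rewrite Cmod_1 in H. lra.
Qed.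

Lemma one_minus_neq_0 (z : C) : (Cmod z < 1)%R -> 1 - z <> 0.
Proof.
  intros Hz. apply Cmod_gt_0. pose proof (Cmod_one_minus_ge z). lra.
Qed.

Lemma Cmod_div_lt (x w : C) (r : R) :
  w <> 0 -> (Cmod x < r * Cmod w)%R -> (Cmod (x / w) < r)%R.
Proof.
  intros Hw H. rewrite Cmod_div by exact Hw. apply Cmod_gt_0 in Hw.
  apply (Rmult_lt_reg_r (Cmod w)); [exact Hw|].
  unfold Rdiv. rewrite Rmult_assoc, Rinv_l by lra. lra.
Qed.

(** Taylor's formula at z, where the k-th derivative of (1 - z)^(-a) is (a)_k (1 - z)^(-a-k). It
    keeps the branch of the power consistent from one disc to the next. *)
Lemma one_minus_pow_opp_plus (z h a : C) :
  (Cmod z + Cmod h < 1)%R ->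
  one_minus_pow_opp (z + h) a =
  one_minus_pow_opp z a * one_minus_pow_opp (h / (1 - z)) a.
Proof.
  intros H. pose proof (Cmod_ge_0 z). pose proof (Cmod_ge_0 h).
  assert (Hz : (Cmod z < 1)%R) by lra.
  assert (N : 1 - z <> 0) by now apply one_minus_neq_0.
  assert (Hq : (Cmod (h / (1 - z)) < 1)%R).
  { apply Cmod_div_lt; [exact N|]. pose proof (Cmod_one_minus_ge z). lra. }
  pose (rho := ((1 + Cmod z + Cmod h) / 2)%R).
  assert (Hr : (0 < rho < 1 /\ Cmod z + Cmod h < rho)%R) by (unfold rho; lra).
  change (egf (Cpochhammer a) (z + h) = one_minus_pow_opp z a
    * one_minus_pow_opp (h / (1 - z)) a).
  rewrite (egf_taylor _ rho); [|lra| |lra].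
  - unfold egf at 1, one_minus_pow_opp at 2.
    rewrite <- CSeries_scal by now apply binomial_term_summable.
    apply CSeries_ext. intros k.
    assert (E : egf (fun n => Cpochhammer a (n + k)) z * (1 - z) ^ k
                = Cpochhammer a k * one_minus_pow_opp z a).
    { rewrite <- (one_minus_pow_opp_add z a k Hz), Cmult_assoc. f_equal.
      unfold one_minus_pow_opp, egf.
      rewrite <- CSeries_scal by now apply binomial_term_summable.
      apply CSeries_ext. intros n. rewrite Nat.add_comm, Cpochhammer_add.
      unfold Cdiv. ring. }
    assert (Nk : (1 - z) ^ k <> 0) by now apply Cpow_nz.
    replace ((h / (1 - z)) ^ k) with (h ^ k / (1 - z) ^ k) by
      (unfold Cdiv; rewrite Cpow_mult_l, Cpow_inv by exact N; reflexivity).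
    replace (egf (fun n => Cpochhammer a (n + k)) z)
      with (Cpochhammer a k * one_minus_pow_opp z a / (1 - z) ^ k)
      by (rewrite <- E; field; exact Nk).
    field. split; [exact Nk | apply INR_fact_C_neq_0].
  - replace rho with (Cmod rho) by (rewrite Cmod_R; apply Rabs_pos_eq; lra).
    apply egf_bounded_of_ex_series.
    exists (one_minus_pow_opp rho a). apply CSeries_correct, binomial_term_summable.
    rewrite Cmod_R, Rabs_pos_eq; lra.
Qed.

Definition factorially_small (phi : nat -> C) : Prop :=
  forall l : R, (1 < l)%R ->
  exists K, forall m, (Cmod (phi m) * INR (fact m) <= K * l ^ m)%R.

(** Formally (a)_k times the series with parameter a + k, the two Pochhammer symbols being merged.
    With coefficients [Mser a phi x k], the exponential generating function in z is the left side of
    the third formula. *)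
Definition Mser (a : C) (phi : nat -> C) (x : C) (k : nat) : C :=
  CSeries (fun m => Cpochhammer a (k + m) * phi m * x ^ m).

Lemma Mser_double (a : C) (phi : nat -> C) (x z : C) (j : nat) :
  factorially_small phi -> (Cmod x + Cmod z < 1)%R ->
  abs_convergent2 (fun k m => Cpochhammer a (k + j + m) * phi m * x ^ m
                              * (z ^ k / INR (fact k))).
Proof.
  intros Hphi H. pose proof (Cmod_ge_0 x). pose proof (Cmod_ge_0 z).
  (* The bounds on phi_m and on the Pochhammer symbol cost l^m and l^(m+k), so |x| is enlarged by
     l^2 and |z| by l. The choice of l means |x| + |z| = 1 - 4 (l - 1), which absorbs both. *)
  pose (l := (1 + (1 - Cmod x - Cmod z) / 4)%R).
  assert (Hl : (1 < l)%R) by (unfold l; lra).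
  assert (Hl1 : (l * l * Cmod x + l * Cmod z < 1)%R).
  { apply Rle_lt_trans with (l * l * (1 - 4 * (l - 1)))%R.
    - replace (1 - 4 * (l - 1))%R with (Cmod x + Cmod z)%R by (unfold l; field).
      assert (0 <= (l - 1) * (l * Cmod z))%R; [|lra].
      apply Rmult_le_pos; [|apply Rmult_le_pos]; lra.
    - replace (l * l * (1 - 4 * (l - 1)))%R
        with (1 - (l - 1) * (2 + (l - 1) * (3 + 4 * l)))%R by ring.
      assert (0 < (l - 1) * (2 + (l - 1) * (3 + 4 * l)))%R; [|lra].
      apply Rmult_lt_0_compat; nra. }
  destruct (Hphi l Hl) as [K HK].
  destruct (Cpochhammer_upper (a + INR j) l Hl) as (L & HL0 & HL).
  destruct (multinomial_geometric (l * l * Cmod x) (l * Cmod z))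
    as (p & q & Hp & Hq & B); [nra | nra | exact Hl1 |].
  assert (K0 : (0 <= K)%R).
  { pose proof (HK O) as T. simpl in T. pose proof (Cmod_ge_0 (phi O)). lra. }
  apply (abs_convergent2_geom (Cmod (Cpochhammer a j) * (L * K)) q p); try assumption.
  intros k m. replace (k + j + m)%nat with (j + (m + k))%nat by lia.
  rewrite Cpochhammer_add, !Cmod_mult, Cmod_div, !Cmod_pow, Cmod_INR
    by apply INR_fact_C_neq_0.
  rewrite !Rmult_assoc. apply Rmult_le_compat_l; [apply Cmod_ge_0|].
  specialize (HL (m + k)%nat). specialize (HK m). specialize (B m k).
  pose proof (INR_fact_lt_0 m) as Pm. pose proof (INR_fact_lt_0 k) as Pk.
  pose proof (INR_fact_lt_0 (m + k)) as Pmk.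
  pose proof (Cmod_ge_0 (Cpochhammer (a + INR j) (m + k))) as PA.
  pose proof (Cmod_ge_0 (phi m)) as PP.
  set (A := Cmod (Cpochhammer (a + INR j) (m + k))) in *.
  set (P := Cmod (phi m)) in *.
  assert (Px : (0 <= Cmod x ^ m)%R) by now apply pow_le.
  assert (Pz : (0 <= Cmod z ^ k)%R) by now apply pow_le.
  apply Rle_trans with
    (A * (P * INR (fact m)) * (/ (INR (fact m) * INR (fact k)) * Cmod x ^ m * Cmod z ^ k))%R.
  { right. field. lra. }
  assert (0 <= / (INR (fact m) * INR (fact k)) * Cmod x ^ m * Cmod z ^ k)%R.
  { repeat apply Rmult_le_pos; try assumption. left. apply Rinv_0_lt_compat. nra. }
  apply Rle_trans with
    (L * (l ^ (m + k) * INR (fact (m + k))) * (K * l ^ m)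
     * (/ (INR (fact m) * INR (fact k)) * Cmod x ^ m * Cmod z ^ k))%R.
  { apply Rmult_le_compat_r; [assumption|]. apply Rmult_le_compat; try assumption.
    apply Rmult_le_pos; lra. }
  apply Rle_trans with (L * K * (p ^ m * q ^ k))%R; [|right; ring].
  apply Rle_trans with (L * K * (INR (fact (m + k)) / (INR (fact m) * INR (fact k))
    * (l * l * Cmod x) ^ m * (l * Cmod z) ^ k))%R.
  - right. rewrite !Rpow_mult_distr, pow_add. field. lra.
  - apply Rmult_le_compat_l; [apply Rmult_le_pos; assumption | exact B].
Qed.

Lemma Mser_summable (a : C) (phi : nat -> C) (x : C) (k : nat) :
  factorially_small phi -> (Cmod x < 1)%R ->
  Csummable (fun m => Cpochhammer a (k + m) * phi m * x ^ m).
Proof.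
  intros Hphi Hx.
  assert (H : (Cmod x + Cmod 0 < 1)%R) by (rewrite Cmod_0; lra).
  generalize (abs_convergent2_row _ 0 (Mser_double a phi x 0 k Hphi H)).
  apply Csummable_ext. intros m. simpl. field.
Qed.

(** After the exchange, the sum over k for fixed m is the binomial series of (1 - z)^(-a-j-m), and
    its m-th power turns x into x / (1 - z). The offset j provides the j-th derivative in z. *)
Lemma Mser_taylor (a : C) (phi : nat -> C) (x z : C) (j : nat) :
  factorially_small phi -> (Cmod x + Cmod z < 1)%R ->
  Csummable (fun k => Mser a phi x (k + j) / INR (fact k) * z ^ k) /\
  egf (fun k => Mser a phi x (k + j)) z =
  one_minus_pow_opp z a / (1 - z) ^ j * Mser a phi (x / (1 - z)) j.
Proof.
  intros Hphi H. pose proof (Cmod_ge_0 x). pose proof (Cmod_ge_0 z).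
  assert (Hz : (Cmod z < 1)%R) by lra.
  assert (N : 1 - z <> 0) by now apply one_minus_neq_0.
  assert (Hxz : (Cmod (x / (1 - z)) < 1)%R).
  { apply Cmod_div_lt; [exact N|]. pose proof (Cmod_one_minus_ge z). lra. }
  assert (D := Mser_double a phi x z j Hphi H).
  assert (E : forall k, CSeries (fun m => Cpochhammer a (k + j + m) * phi m * x ^ m
                                          * (z ^ k / INR (fact k)))
                        = Mser a phi x (k + j) / INR (fact k) * z ^ k).
  { intros k. rewrite CSeries_scal_r.
    - unfold Mser, Cdiv. ring.
    - apply Mser_summable; [exact Hphi | lra]. }
  split; [exact (Csummable_ext _ _ E (abs_convergent2_sums _ D))|].
  unfold egf. rewrite <- (CSeries_ext _ _ E).
  etransitivity; [exact (CSeries2_swap _ D)|]. unfold CSeries2, Mser at 1.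
  rewrite <- CSeries_scal by now apply Mser_summable.
  apply CSeries_ext. intros m.
  transitivity (Cpochhammer a (j + m) * phi m * x ^ m
                * one_minus_pow_opp z (a + INR (j + m))).
  - unfold one_minus_pow_opp.
    rewrite <- CSeries_scal by now apply binomial_term_summable.
    apply CSeries_ext. intros k.
    replace (k + j + m)%nat with ((j + m) + k)%nat by lia.
    rewrite Cpochhammer_add. unfold Cdiv. ring.
  - rewrite <- (one_minus_pow_opp_add z a (j + m) Hz), Cpow_add_r.
    unfold Cdiv. rewrite Cpow_mult_l, Cpow_inv by exact N.
    field. split; now apply Cpow_nz.
Qed.

(** * Analytic continuation *)

(** The two bounds on h serve the two sides: |1 - w| + |h| < rho allows the re-expansion at 1 - w,
    and |x| + |h| < |w| says |x / w| + |h / w| < 1, as [Mser_taylor] requires. *)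
Lemma Mser_chain_step (a : C) (phi : nat -> C) (x w h : C) (rho : R) :
  factorially_small phi -> (0 < rho <= 1)%R -> egf_bounded (Mser a phi x) rho ->
  (Cmod (1 - w) + Cmod h < rho)%R -> (Cmod x + Cmod h < Cmod w)%R ->
  (forall k, egf (fun n => Mser a phi x (n + k)) (1 - w) =
             one_minus_pow_opp (1 - w) a / w ^ k * Mser a phi (x / w) k) ->
  (forall k, egf (fun n => Mser a phi x (n + k)) (1 - (w - h)) =
             one_minus_pow_opp (1 - (w - h)) a / (w - h) ^ k
             * Mser a phi (x / (w - h)) k).
Proof.
  intros Hphi Hr Hb H1 H2 Q j.
  pose proof (Cmod_ge_0 x). pose proof (Cmod_ge_0 h). pose proof (Cmod_ge_0 (1 - w)).
  assert (Hw : w <> 0) by (apply Cmod_gt_0; lra).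
  assert (Hwh : w - h <> 0).
  { apply Cmod_gt_0. pose proof (Cmod_triangle (w - h) h) as T.
    replace (w - h + h) with w in T by ring. lra. }
  assert (Hq : (Cmod (x / w) + Cmod (h / w) < 1)%R).
  { rewrite !Cmod_div by exact Hw. apply (Rmult_lt_reg_r (Cmod w)); [lra|].
    replace ((Cmod x / Cmod w + Cmod h / Cmod w) * Cmod w)%R with (Cmod x + Cmod h)%R
      by (field; lra). lra. }
  replace (1 - (w - h)) with (1 - w + h) by ring.
  rewrite one_minus_pow_opp_plus by lra.
  replace (1 - (1 - w)) with w by ring.
  (* The derivatives are bounded only at radii below rho, so a radius halfway between |1 - w| + |h|
     and rho is used. *)
  pose (r := ((Cmod (1 - w) + Cmod h + rho) / 2)%R).
  assert (Hrr : (0 < r < rho /\ Cmod (1 - w) + Cmod h < r)%R) by (unfold r; lra).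
  rewrite (egf_taylor _ r); [|lra| |lra].
  2: { apply (egf_bounded_shift (Mser a phi x) rho); [lra | exact Hb]. }
  destruct (Mser_taylor a phi (x / w) (h / w) j Hphi Hq) as [S T].
  transitivity (one_minus_pow_opp (1 - w) a / w ^ j
    * egf (fun k => Mser a phi (x / w) (k + j)) (h / w)).
  - unfold egf at 1, egf at 2. rewrite <- CSeries_scal by exact S.
    apply CSeries_ext. intros k.
    replace (egf (fun n => Mser a phi x (n + k + j)) (1 - w))
      with (one_minus_pow_opp (1 - w) a / w ^ (k + j) * Mser a phi (x / w) (k + j)).
    + unfold Cdiv. rewrite Cpow_mult_l, Cpow_inv, Cpow_add_r by exact Hw.
      field. repeat split; try apply INR_fact_C_neq_0; now apply Cpow_nz.
    + rewrite <- Q. apply CSeries_ext. intros n.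
      now replace (n + (k + j))%nat with (n + k + j)%nat by lia.
  - rewrite T. replace (x / w / (1 - h / w)) with (x / (w - h)) by
      (field; repeat split; assumption).
    assert (E : w ^ j * (1 - h / w) ^ j = (w - h) ^ j).
    { rewrite <- Cpow_mult_l. f_equal. field. exact Hw. }
    rewrite <- E. field. split; apply Cpow_nz; [|exact Hw].
    intros Z. apply Hwh. replace (w - h) with (w * (1 - h / w)) by (field; exact Hw).
    rewrite Z. ring.
Qed.

(** With N > L / d equal pieces of [0, 1], each piece moves g by less than d. *)
Lemma lipschitz_chain (Q : C -> Prop) (g : R -> C) (L d : R) :
  (0 < d)%R ->
  (forall s t, 0 <= s <= 1 -> 0 <= t <= 1 -> Cmod (g t - g s) <= L * Rabs (t - s))%R ->
  (forall s t, (0 <= s <= 1)%R -> (0 <= t <= 1)%R ->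
     (Cmod (g t - g s) < d)%R -> Q (g s) -> Q (g t)) ->
  Q (g 0%R) -> Q (g 1%R).
Proof.
  intros Hd HL Hstep H0.
  destruct (INR_unbounded (Rmax 1 (L / d))) as [N HN].
  pose proof (Rmax_l 1 (L / d)). pose proof (Rmax_r 1 (L / d)).
  assert (F : forall i, (i <= N)%nat -> Q (g (INR i / INR N)%R)).
  { assert (B : forall i, (i <= N)%nat -> (0 <= INR i / INR N <= 1)%R).
    { intros i Hi. apply le_INR in Hi. pose proof (pos_INR i).
      assert (0 < / INR N)%R by (apply Rinv_0_lt_compat; lra). split.
      - apply Rmult_le_pos; lra.
      - apply (Rmult_le_reg_r (INR N)); [lra|].
        unfold Rdiv. rewrite Rmult_assoc, Rinv_l by lra. lra. }
    induction i as [|i IH]; intros Hi.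
    - simpl. unfold Rdiv. now rewrite Rmult_0_l.
    - apply (Hstep (INR i / INR N)%R); [apply B; lia | apply B; lia | | apply IH; lia].
      eapply Rle_lt_trans; [apply HL; apply B; lia|].
      rewrite S_INR. replace ((INR i + 1) / INR N - INR i / INR N)%R with (/ INR N)%R
        by (field; lra).
      rewrite Rabs_pos_eq by (left; apply Rinv_0_lt_compat; lra).
      apply (Rmult_lt_reg_r (INR N / d)).
      + apply Rmult_lt_0_compat; [lra | now apply Rinv_0_lt_compat].
      + replace (L * / INR N * (INR N / d))%R with (L / d)%R by (field; lra).
        replace (d * (INR N / d))%R with (INR N) by (field; lra). lra. }
  specialize (F N (Nat.le_refl N)).
  unfold Rdiv in F. now rewrite Rinv_r in F by lra.
Qed.

Lemma Cmod_le_sq (z : C) (B : R) :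
  (0 <= B)%R -> (Re z ^ 2 + Im z ^ 2 <= B ^ 2)%R -> (Cmod z <= B)%R.
Proof.
  intros HB H. rewrite <- Cmod2_alt in H. apply Rsqr_incr_0_var; [|exact HB].
  now rewrite !Rsqr_pow2.
Qed.

(** A chord is at most its arc: the left side is |1 - e^(iu)|^2. *)
Lemma one_minus_cos_le (u : R) : (2 - 2 * cos u <= u ^ 2)%R.
Proof.
  assert (P : forall v, (0 <= v)%R -> (sin v ^ 2 <= v ^ 2)%R).
  { intros v Hv. destruct (Rle_lt_dec 1 v) as [H|H].
    - pose proof (SIN_bound v). nra.
    - destruct Hv as [Hv| <-]; [|rewrite sin_0; lra].
      pose proof (sin_lt_x v Hv). pose proof PI_4. pose proof PI2_3_2.
      assert (0 <= sin v)%R by (apply sin_ge_0; lra). nra. }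
  replace u with (2 * (u / 2))%R by field. rewrite cos_2a_sin.
  destruct (Rle_lt_dec 0 (u / 2)) as [H|H].
  - specialize (P _ H). nra.
  - specialize (P (- (u / 2))%R ltac:(lra)). rewrite sin_neg in P. nra.
Qed.

(* The radial path from 1 to [w] may leave the region, so the path follows the
   real axis from 1 to |w| and then the circle of radius |w|. *)
Lemma lune_chain (Q : C -> Prop) (w : C) (d : R) :
  (0 < d)%R -> w <> 0 ->
  (forall v v', (Rmin 1 (Cmod w) <= Cmod v)%R -> (Cmod (1 - v) <= Cmod (1 - w))%R ->
     (Cmod (v' - v) < d)%R -> Q v -> Q v') ->
  Q 1 -> Q w.
Proof.
  intros Hd Hw Hstep H1. apply Cmod_gt_0 in Hw.
  set (s := Cmod w) in *.
  assert (Hs : Q (RtoC s)).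
  { replace s with (1 + 1 * (s - 1))%R by ring.
    apply (lipschitz_chain Q (fun t => RtoC (1 + t * (s - 1))) (Rabs (s - 1)) d Hd).
    - intros u t _ _. rewrite <- RtoC_minus, Cmod_R.
      replace (1 + t * (s - 1) - (1 + u * (s - 1)))%R with ((s - 1) * (t - u))%R by ring.
      rewrite Rabs_mult. lra.
    - intros u t Hu _. apply Hstep.
      + rewrite Cmod_R. apply Rle_trans with (2 := Rle_abs _).
        unfold Rmin. destruct Rle_dec; nra.
      + rewrite <- RtoC_minus, Cmod_R.
        replace (1 - (1 + u * (s - 1)))%R with (u * (1 - s))%R by ring.
        rewrite Rabs_mult, Rabs_pos_eq by lra.
        pose proof (Rabs_pos (1 - s)).
        apply Rle_trans with (Rabs (1 - s)); [nra|].
        (* The reverse triangle inequality | |w| - 1 | <= |1 - w| keeps the real segment in the disc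
           around 1. *)
        pose proof (Cmod_triangle (1 - w) w) as T1.
        replace (1 - w + w) with (RtoC 1) in T1 by ring.
        pose proof (Cmod_triangle (- (1 - w)) 1) as T2.
        replace (- (1 - w) + 1) with w in T2 by ring.
        rewrite Cmod_opp in T2. rewrite Cmod_1 in *. fold s in T1, T2.
        apply Rabs_le. lra.
    - replace (1 + 0 * (s - 1))%R with 1%R by ring. exact H1. }
  assert (Es : (Re w ^ 2 + Im w ^ 2 = s ^ 2)%R) by (symmetry; apply Cmod2_alt).
  pose (th := acos (Re w / s)).
  assert (Hc : (-1 <= Re w / s <= 1)%R).
  { split; apply (Rmult_le_reg_r s); try assumption;
      unfold Rdiv; rewrite Rmult_assoc, Rinv_l by lra; nra. }
  assert (Hth : (0 <= th <= PI)%R) by apply acos_bound.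
  assert (Cth : (s * cos th = Re w)%R).
  { unfold th. rewrite cos_acos by exact Hc. field. lra. }
  assert (Sth : (0 <= s * sin th)%R).
  { apply Rmult_le_pos; [lra|]. now apply sin_ge_0. }
  assert (Sth2 : ((s * sin th) ^ 2 = Im w ^ 2)%R).
  { pose proof (sin2_cos2 th) as E. unfold Rsqr in E. nra. }
  (* The angle from [acos] describes only the closed upper half-plane; the sign e reflects the arc
     when Im w < 0. *)
  assert (He : exists e, (e ^ 2 = 1)%R /\ (e * (s * sin th) = Im w)%R).
  { destruct (Rle_lt_dec 0 (Im w)); [exists 1%R | exists (-1)%R]; split; nra. }
  destruct He as (e & He & Ee).
  pose (g := fun t : R => (s * cos (t * th), e * (s * sin (t * th)))%R : C).
  assert (G1 : g 1%R = w).
  { unfold g. rewrite Rmult_1_l, Cth, Ee. now destruct w. }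
  assert (G0 : g 0%R = RtoC s).
  { unfold g. rewrite Rmult_0_l, cos_0, sin_0. unfold RtoC. f_equal; ring. }
  rewrite <- G1. rewrite <- G0 in Hs.
  refine (lipschitz_chain Q g (s * th) d Hd _ _ Hs).
  - intros u t _ _. apply Cmod_le_sq.
    + apply Rmult_le_pos; [nra | apply Rabs_pos].
    + unfold g; simpl Re; simpl Im.
      pose proof (one_minus_cos_le (t * th - u * th)) as B. rewrite cos_minus in B.
      rewrite Rpow_mult_distr, pow2_abs.
      pose proof (sin2_cos2 (t * th)) as E1. pose proof (sin2_cos2 (u * th)) as E2.
      unfold Rsqr in E1, E2.
      apply Rle_trans with (s ^ 2 * (2 - 2 * (cos (t * th) * cos (u * th)
        + sin (t * th) * sin (u * th))))%R.
      * right. transitivity (s ^ 2 * (cos (t * th) - cos (u * th)) ^ 2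
          + e ^ 2 * (s ^ 2 * (sin (t * th) - sin (u * th)) ^ 2))%R; [ring|].
        rewrite He. transitivity (s ^ 2 *
          ((sin (t * th) * sin (t * th) + cos (t * th) * cos (t * th))
           + (sin (u * th) * sin (u * th) + cos (u * th) * cos (u * th))
           - 2 * (cos (t * th) * cos (u * th) + sin (t * th) * sin (u * th))))%R;
          [ring|].
        rewrite E1, E2. ring.
      * replace ((s * th) ^ 2 * (t - u) ^ 2)%R with (s ^ 2 * (t * th - u * th) ^ 2)%R
          by ring.
        apply Rmult_le_compat_l; [apply pow2_ge_0 | exact B].
  - intros u t Hu _. pose proof (sin2_cos2 (u * th)) as E1. unfold Rsqr in E1.
    apply Hstep.
    + apply Rle_trans with (1 := Rmin_r _ _). right.
      assert (E : (Cmod (g u) ^ 2 = s ^ 2)%R).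
      { rewrite Cmod2_alt. unfold g; simpl Re; simpl Im.
        rewrite (Rpow_mult_distr e), He. nra. }
      pose proof (Cmod_ge_0 (g u)). nra.
    + apply Cmod_le_sq; [apply Cmod_ge_0|]. rewrite Cmod2_alt.
      (* On the circle, |1 - v|^2 = 1 + s^2 - 2 s cos(angle), which increases with the angle on
         [0, PI]; hence no point of the arc is farther from 1 than w. *)
      assert (cos th <= cos (u * th))%R by (apply cos_decr_1; nra).
      unfold g; simpl Re; simpl Im. unfold Re, Im in *.
      replace ((0 + - (e * (s * sin (u * th)))) ^ 2)%R
        with (e ^ 2 * (s * sin (u * th)) ^ 2)%R by ring.
      rewrite He. nra.
Qed.

(** Bounded terms give a radius of convergence of at least 1. Above 1 the sum is continuous at 1; at
    exactly 1 this is Abel's theorem. *)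
Lemma Abel_at_1 (u : nat -> R) :
  ex_series u ->
  filterlim (fun t => Series (fun n => u n * t ^ n)%R) (at_left 1)
    (locally (Series u)).
Proof.
  intros H.
  assert (E1 : ex_pseries u 1).
  { apply (ex_series_ext u); [|exact H]. intros n.
    rewrite pow_n_pow, pow1. symmetry. apply Rmult_1_l. }
  assert (S1 : PSeries u 1 = Series u).
  { apply Series_ext. intros n. rewrite pow1. apply Rmult_1_r. }
  rewrite <- S1. change (filterlim (PSeries u) (at_left 1) (locally (PSeries u 1))).
  assert (R1 : Rbar_le 1 (CV_radius u)).
  { apply (proj1 (CV_radius_bounded u) 1%R).
    destruct (filterlim_bounded (V := R_NormedModule) u) as [M HM].
    { exists 0%R. exact (ex_series_lim_0 u H). }
    exists M. intros n. rewrite pow1, Rmult_1_r. apply HM. }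
  destruct (Rbar_le_lt_or_eq_dec _ _ R1) as [L|E].
  - assert (Ct : continuity_pt (PSeries u) 1).
    { apply PSeries_continuity. now rewrite Rabs_R1. }
    apply continuity_pt_filterlim in Ct. intros P HP. generalize (Ct P HP).
    unfold filtermap, at_left, within. apply filter_imp. intros t Ht _. exact Ht.
  - pose proof (Abel u) as A. rewrite <- E in A. apply A; simpl; trivial. lra.
Qed.

(** Both expansions tend to their sums at the endpoint as t increases to 1; the affine change of
    variable fixes 1 and centres the second one at t0. Since t is real, real and imaginary parts
    separate. *)
Lemma Abel_unique (u e : nat -> C) (t0 : R) (l1 l2 : C) :
  (t0 < 1)%R -> is_series u l1 -> is_series e l2 ->
  (forall t, (t0 < t < 1)%R ->
     CSeries (fun n => u n * RtoC t ^ n)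
     = CSeries (fun n => e n * RtoC ((t - t0) / (1 - t0)) ^ n)) ->
  l1 = l2.
Proof.
  intros Ht0 Hu He H.
  assert (P : forall (f : C -> R),
    (forall v t, f (CSeries (fun n => v n * RtoC t ^ n))
                 = Series (fun n => f (v n) * t ^ n)%R) ->
    is_series (fun n => f (u n)) (f l1) -> is_series (fun n => f (e n)) (f l2) ->
    f l1 = f l2).
  { intros f Hf Fu Fe.
    pose proof (Abel_at_1 _ (ex_intro _ _ Fu)) as A1.
    pose proof (Abel_at_1 _ (ex_intro _ _ Fe)) as A2.
    rewrite (is_series_unique _ _ Fu) in A1. rewrite (is_series_unique _ _ Fe) in A2.
    refine (filterlim_locally_unique (F := at_left 1) _ _ _ A1 _).
    refine (filterlim_ext_loc
      (fun t => Series (fun n => f (e n) * ((t - t0) / (1 - t0)) ^ n)%R) _ _ _).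
    - exists (mkposreal (1 - t0) (proj2 (Rlt_0_minus _ _) Ht0)).
      intros t Bt Lt. rewrite <- !Hf. f_equal. symmetry. apply H.
      split; [|exact Lt]. change (Rabs (t - 1) < 1 - t0)%R in Bt.
      apply Rabs_def2 in Bt. lra.
    - refine (filterlim_comp _ _ _ (fun t => (t - t0) / (1 - t0))%R _ _ (at_left 1) _ _ A2).
      intros Q [d Hd].
      exists (mkposreal (d * (1 - t0)) (Rmult_lt_0_compat _ _ (cond_pos d)
        (proj2 (Rlt_0_minus _ _) Ht0))).
      intros t Bt Lt. change (Rabs (t - 1) < d * (1 - t0))%R in Bt.
      assert (E : ((t - t0) / (1 - t0) = 1 + (t - 1) / (1 - t0))%R) by (field; lra).
      assert (Ip : (0 < / (1 - t0))%R) by (apply Rinv_0_lt_compat; lra).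
      apply Hd.
      + change (Rabs ((t - t0) / (1 - t0) - 1) < d)%R.
        rewrite E. replace (1 + (t - 1) / (1 - t0) - 1)%R
          with ((t - 1) * / (1 - t0))%R by (unfold Rdiv; ring).
        rewrite Rabs_mult, (Rabs_pos_eq (/ (1 - t0))) by lra.
        apply (Rmult_lt_reg_r (1 - t0)); [lra|].
        rewrite Rmult_assoc, Rinv_l by lra. lra.
      + rewrite E. unfold Rdiv. nra. }
  apply is_series_C_iff in Hu. apply is_series_C_iff in He.
  destruct l1 as [x1 y1], l2 as [x2 y2]. f_equal.
  - apply (P Re); try tauto. intros v t.
    apply Series_ext. intros n.
    now rewrite <- RtoC_pow, re_scal_r.
  - apply (P Im); try tauto. intros v t.
    apply Series_ext. intros n.
    now rewrite <- RtoC_pow, im_scal_r.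
Qed.

Lemma Mser_boundary (a : C) (phi : nat -> C) (x z : C) :
  factorially_small phi -> (Cmod x < 1)%R -> (Cmod z < 1)%R ->
  (Cmod (x / (1 - z)) < 1)%R -> (0 < Cmod z)%R ->
  ex_series (fun k => Mser a phi x k / INR (fact k) * z ^ k) ->
  is_series (fun k => Mser a phi x k / INR (fact k) * z ^ k)
    (one_minus_pow_opp z a * Mser a phi (x / (1 - z)) 0).
Proof.
  intros Hphi Hx Hz Hxz Hz0 Hex.
  assert (N : 1 - z <> 0) by now apply one_minus_neq_0.
  assert (Hg : (Cmod x < Cmod (1 - z))%R).
  { rewrite Cmod_div in Hxz by exact N. apply Cmod_gt_0 in N.
    apply (Rmult_lt_compat_r (Cmod (1 - z))) in Hxz; [|exact N].
    unfold Rdiv in Hxz. rewrite Rmult_assoc, Rinv_l in Hxz by lra. lra. }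
  pose proof (Cmod_ge_0 x) as Hx0.
  assert (Hg2 : (Cmod (1 - z) <= 2)%R).
  { pose proof (Cmod_triangle 1 (- z)) as T. rewrite Cmod_opp, Cmod_1 in T.
    unfold Cminus. lra. }
  assert (Hb := egf_bounded_of_ex_series _ _ Hex).
  (* The intermediate point t0 z lies strictly inside the disc of radius |z|. As |1 - z| - |x| = 4 e
     and |h| = e |z| < e, the bound |w| >= |1 - z| - |h| leaves |x| + |h| < |w|. *)
  pose (e := ((Cmod (1 - z) - Cmod x) / 4)%R).
  assert (He : (0 < e <= 1 / 2)%R) by (unfold e; lra).
  pose (t0 := (1 - e)%R). pose (w := 1 - RtoC t0 * z). pose (h := RtoC e * z).
  assert (Eh : Cmod h = (e * Cmod z)%R).
  { unfold h. rewrite Cmod_mult, Cmod_R, Rabs_pos_eq; lra. }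
  assert (Ewh : w - h = 1 - z).
  { unfold w, h, t0. rewrite RtoC_minus. ring. }
  assert (E1w : 1 - w = RtoC t0 * z) by (unfold w; ring).
  assert (Hw : (Cmod (1 - z) - e * Cmod z <= Cmod w)%R).
  { pose proof (Cmod_triangle w (- h)) as T. rewrite Cmod_opp, Eh in T.
    fold (w - h) in T. rewrite Ewh in T. lra. }
  assert (H1w : (Cmod (1 - w) = t0 * Cmod z)%R).
  { rewrite E1w, Cmod_mult, Cmod_R, Rabs_pos_eq; unfold t0; lra. }
  assert (Hxw : (Cmod x + Cmod h < Cmod w)%R).
  { rewrite Eh. unfold e in *. nra. }
  assert (Hw0 : w <> 0).
  { apply Cmod_gt_0. pose proof (Cmod_ge_0 h). lra. }
  assert (Q : forall k, egf (fun n => Mser a phi x (n + k)) (1 - w) =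
             one_minus_pow_opp (1 - w) a / w ^ k * Mser a phi (x / w) k).
  { pose (mu := Rmin 1 (Cmod w)).
    assert (Hmu : (Cmod x < mu)%R).
    { apply Rmin_glb_lt; [exact Hx|]. pose proof (Cmod_ge_0 h). lra. }
    (* At every v visited, |v| >= mu and |1 - v| <= |1 - w|, so a step shorter than both mu - |x|
       and |z| - |1 - w| meets the two conditions of [Mser_chain_step]. *)
    apply (lune_chain (fun w => forall k, egf (fun n => Mser a phi x (n + k)) (1 - w) =
             one_minus_pow_opp (1 - w) a / w ^ k * Mser a phi (x / w) k) w
             (Rmin (mu - Cmod x) (Cmod z - Cmod (1 - w)))).
    - apply Rmin_glb_lt; [lra|]. rewrite H1w. unfold t0. nra.
    - exact Hw0.
    - intros v v' Hv1 Hv2 Hv IH. fold mu in Hv1.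
      pose proof (Rmin_l (mu - Cmod x) (Cmod z - Cmod (1 - w))).
      pose proof (Rmin_r (mu - Cmod x) (Cmod z - Cmod (1 - w))).
      assert (Ev : Cmod (v - v') = Cmod (v' - v)).
      { rewrite <- Cmod_opp. f_equal. ring. }
      replace v' with (v - (v - v')) by ring.
      apply (Mser_chain_step a phi x v (v - v') (Cmod z)); trivial;
        rewrite ?Ev; lra.
    - intros k. replace (1 - 1) with (RtoC 0) by ring. rewrite egf_0.
      change (one_minus_pow_opp 0 a) with (egf (Cpochhammer a) 0).
      rewrite egf_0, Cpow_1_l. simpl. replace (x / 1) with x by field. field. }
  destruct (Mser_taylor a phi (x / w) (h / w) 0 Hphi) as [S T].
  { rewrite !Cmod_div by exact Hw0. apply Cmod_gt_0 in Hw0.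
    apply (Rmult_lt_reg_r (Cmod w)); [exact Hw0|].
    replace ((Cmod x / Cmod w + Cmod h / Cmod w) * Cmod w)%R with (Cmod x + Cmod h)%R
      by (field; lra). lra. }
  pose (c := fun k => Mser a phi (x / w) (k + 0) / INR (fact k) * (h / w) ^ k).
  (* The expansion around w converges absolutely at h, that is at the target w - h = 1 - z, and its
     sum there is the value sought. *)
  assert (L2 : is_series (fun k => one_minus_pow_opp (1 - w) a * c k)
    (one_minus_pow_opp z a * Mser a phi (x / (1 - z)) 0)).
  { replace (one_minus_pow_opp z a * Mser a phi (x / (1 - z)) 0)
      with (CSeries (fun k => one_minus_pow_opp (1 - w) a * c k)).
    - apply CSeries_correct. now apply Csummable_scal.
    - rewrite CSeries_scal by exact S. change (CSeries c) with
        (egf (fun k => Mser a phi (x / w) (k + 0)) (h / w)).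
      rewrite T. replace (x / w / (1 - h / w)) with (x / (1 - z)).
      + transitivity (one_minus_pow_opp (1 - w) a * one_minus_pow_opp (h / w) a
          * Mser a phi (x / (1 - z)) 0); [simpl; field|].
        f_equal. replace z with (1 - w + h).
        * rewrite one_minus_pow_opp_plus by (rewrite H1w, Eh; unfold t0; lra).
          now replace (1 - (1 - w)) with w by ring.
        * transitivity (1 - (w - h)); [ring|]. rewrite Ewh. ring.
      + rewrite <- Ewh. field. rewrite Ewh. now repeat split. }
  rewrite <- (Abel_unique _ _ t0 _ _ ltac:(unfold t0; lra)
    (ex_series_C_correct _ Hex) L2).
  - now apply ex_series_C_correct.
  - intros t Ht. assert (t0 < 1)%R by (unfold t0; lra).
    (* On the segment, t z = t0 z + s h with 0 < s < 1, so both expansions describe f there. *)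
    assert (Et : (t - t0 = (t - t0) / (1 - t0) * e)%R) by (unfold t0; field; lra).
    set (s := ((t - t0) / (1 - t0))%R) in *.
    transitivity (egf (Mser a phi x) (1 - w + RtoC s * h)).
    + apply CSeries_ext. intros n. rewrite E1w.
      replace (RtoC t0 * z + RtoC s * h) with (RtoC t * z).
      * rewrite Cpow_mult_l. ring.
      * unfold h. rewrite Cmult_assoc, <- RtoC_mult, <- Et, RtoC_minus. ring.
    + rewrite (egf_taylor _ (Cmod z)); trivial.
      * apply CSeries_ext. intros k.
        transitivity (egf (fun n => Mser a phi x (n + k)) (1 - w)
          / INR (fact k) * (RtoC s * h) ^ k); [reflexivity|].
        rewrite Q. unfold c. rewrite Nat.add_0_r. unfold Cdiv.
        rewrite !Cpow_mult_l, Cpow_inv by exact Hw0. ring.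
      * rewrite H1w, Cmod_mult, Eh, Cmod_R, Rabs_pos_eq.
        -- rewrite <- Rmult_assoc, <- Et. nra.
        -- unfold s. apply Rmult_le_pos; [lra|]. left. apply Rinv_0_lt_compat. lra.
Qed.

Lemma Mser_summation (a : C) (phi : nat -> C) (x z : C) :
  factorially_small phi -> (Cmod x < 1)%R -> (Cmod z < 1)%R ->
  (Cmod (x / (1 - z)) < 1)%R ->
  (Cmod x + Cmod z < 1)%R
  \/ ex_series (fun k => Mser a phi x k / INR (fact k) * z ^ k) ->
  is_series (fun k => Mser a phi x k / INR (fact k) * z ^ k)
    (one_minus_pow_opp z a * Mser a phi (x / (1 - z)) 0).
Proof.
  intros Hphi Hx Hz Hxz H.
  destruct (Rlt_le_dec (Cmod x + Cmod z) 1) as [L|L].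
  - destruct (Mser_taylor a phi x z 0 Hphi L) as [S T].
    replace (one_minus_pow_opp z a * Mser a phi (x / (1 - z)) 0)
      with (one_minus_pow_opp z a / (1 - z) ^ 0 * Mser a phi (x / (1 - z)) 0)
      by (simpl; field).
    rewrite <- T.
    assert (E : forall k, Mser a phi x (k + 0) / INR (fact k) * z ^ k
                          = Mser a phi x k / INR (fact k) * z ^ k).
    { intros k. now rewrite Nat.add_0_r. }
    apply (is_series_ext _ _ _ E). exact (CSeries_correct _ S).
  (* Here |x| < 1 <= |x| + |z| forces z to be nonzero, so the disc of radius |z| is not
     degenerate. *)
  - destruct H as [H|H]; [lra|]. apply Mser_boundary; trivial. lra.
Qed.

(** * Shifting a numerator parameter *)

Definition discrete_pochhammer (t : C) (k m : nat) : C :=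
  (-(1)) ^ (m * k) * Cpochhammer (- t) (m * k).

Definition appell_factor (a b t : C) (k : nat) (x : C) (m : nat) : C :=
  Cpochhammer a m * discrete_pochhammer t k m * x ^ m
  * (Cpochhammer b m / INR (fact m)).

(** The indices interact only through (c)_(m+n). With an arbitrary second sequence, shifts of [b1]
    and of [b2] become one statement up to exchanging the indices. *)
Definition coupled (c : C) (al be : nat -> C) (m n : nat) : C :=
  al m * (be n / Cpochhammer c (m + n)).

Lemma discrete_pochhammer_add (t : C) (k s m : nat) :
  discrete_pochhammer t k (s + m) =
  discrete_pochhammer t k s * discrete_pochhammer (t - INR (s * k)) k m.
Proof.
  unfold discrete_pochhammer.
  rewrite Nat.mul_add_distr_r, Cpow_add_r, Cpochhammer_add.
  replace (- (t - INR (s * k))) with (- t + INR (s * k)) by ring. ring.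
Qed.

Lemma discrete_pochhammer_eq_0_le (t : C) (k m n : nat) :
  (m <= n)%nat -> discrete_pochhammer t k m = 0 -> discrete_pochhammer t k n = 0.
Proof.
  intros H E. replace n with (m + (n - m))%nat by lia.
  rewrite discrete_pochhammer_add, E. ring.
Qed.

Lemma F3_term_coupled (a1 a2 b1 b2 c t1 t2 : C) (k1 k2 : nat) (x y : C) (m n : nat) :
  (forall n, c + INR n <> 0) ->
  F3_term a1 a2 b1 b2 c t1 t2 k1 k2 x y m n =
  coupled c (appell_factor a1 b1 t1 k1 x) (appell_factor a2 b2 t2 k2 y) m n.
Proof.
  intros Hc. unfold F3_term, coupled, appell_factor, discrete_pochhammer.
  field. repeat split; try apply INR_fact_C_neq_0. now apply Cpochhammer_neq_0.
Qed.

Lemma coupled_comm (c : C) (al be : nat -> C) (m n : nat) :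
  coupled c al be m n = coupled c be al n m.
Proof.
  unfold coupled. rewrite Nat.add_comm. unfold Cdiv. ring.
Qed.

Lemma appell_factor_0 (a b t : C) (k : nat) (x : C) :
  appell_factor a b t k x 0 <> 0.
Proof.
  unfold appell_factor, discrete_pochhammer. simpl.
  replace (1 * (1 * 1) * 1 * (1 / 1)) with (RtoC 1) by field. exact C1_nz.
Qed.

(** Split (c)_(m+n) = (c)_n (c + n)_m; [Cpochhammer_lower] bounds the second factor from below
    uniformly in n. *)
Lemma coupled_row_bound (c : C) (be : nat -> C) (l : R) :
  (forall n, c + INR n <> 0) -> (1 < l)%R ->
  exists K, (0 <= K)%R /\ forall m n,
    (Cmod (be n / Cpochhammer c (m + n)) * INR (fact m)
     <= K * l ^ m * Cmod (be n / Cpochhammer c n))%R.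
Proof.
  intros Hc Hl. destruct (Cpochhammer_lower c l Hl Hc) as (K & HK & H).
  exists K. split; [exact HK|]. intros m n.
  rewrite Nat.add_comm, Cpochhammer_add.
  assert (N1 : Cpochhammer c n <> 0) by now apply Cpochhammer_neq_0.
  assert (N2 : Cpochhammer (c + INR n) m <> 0).
  { apply Cpochhammer_neq_0. intros k. rewrite <- Cplus_assoc, <- INR_plus_C. apply Hc. }
  rewrite !Cmod_div, Cmod_mult by (try apply Cmult_neq_0; assumption).
  specialize (H n m). apply Cmod_gt_0 in N1. apply Cmod_gt_0 in N2.
  pose proof (Cmod_ge_0 (be n)).
  apply (Rmult_le_reg_r (Cmod (Cpochhammer c n) * Cmod (Cpochhammer (c + INR n) m)));
    [now apply Rmult_lt_0_compat|].
  apply Rle_trans with (Cmod (be n) * INR (fact m))%R; [right; field; lra|].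
  apply Rle_trans with
    (Cmod (be n) * (K * (l ^ m * Cmod (Cpochhammer (c + INR n) m))))%R;
    [now apply Rmult_le_compat_l | right; field; lra].
Qed.

Lemma coupled_row_summable (c : C) (be : nat -> C) (m : nat) :
  (forall n, c + INR n <> 0) -> Csummable (fun n => be n / Cpochhammer c n) ->
  Csummable (fun n => be n / Cpochhammer c (m + n)).
Proof.
  intros Hc H. destruct (coupled_row_bound c be 2 Hc) as (K & HK & HB); [lra|].
  apply (Csummable_le _ (fun n => K * 2 ^ m * Cmod (be n / Cpochhammer c n))%R).
  - intros n. specialize (HB m n).
    assert (1 <= INR (fact m))%R by (apply (le_INR 1), lt_O_fact).
    pose proof (Cmod_ge_0 (be n / Cpochhammer c (m + n))). nra.
  - exact (ex_series_scal (K * 2 ^ m)%R _ H).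
Qed.

Lemma coupled_base_summable (c : C) (al be : nat -> C) :
  al O <> 0 -> abs_convergent2 (coupled c al be) ->
  Csummable (fun n => be n / Cpochhammer c n).
Proof.
  intros H0 H. generalize (Csummable_scal (/ al O) _ (abs_convergent2_row _ O H)).
  apply Csummable_ext. intros n. unfold coupled. simpl.
  rewrite Cmult_assoc, Cinv_l by exact H0. apply Cmult_1_l.
Qed.

(** The bound is asked only eventually: if b + r is a nonpositive integer and r > 0, then (b + r)_m
    vanishes for some m at which (b)_m does not yet vanish. *)
Definition dominated (u v : nat -> C) : Prop :=
  exists K M, (0 <= K)%R /\
    forall m, (M <= m)%nat -> (Cmod (u m) <= K * Cmod (v m))%R.

Lemma dominated_refl (u : nat -> C) : dominated u u.
Proof. exists 1%R, O. split; [lra|]. intros. lra. Qed.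

Lemma dominated_trans (u v w : nat -> C) :
  dominated u v -> dominated v w -> dominated u w.
Proof.
  intros (K & M & HK & H) (K' & M' & HK' & H'). exists (K * K')%R, (max M M').
  split; [now apply Rmult_le_pos|]. intros m Hm.
  apply Rle_trans with (K * Cmod (v m))%R; [apply H; lia|].
  rewrite Rmult_assoc. apply Rmult_le_compat_l; [exact HK | apply H'; lia].
Qed.

(** The sum of the moduli in row m is |al_m| times a quantity independent of al, so domination
    controls all late rows. The finitely many others converge because row 0 of the given series does
    and al_0 is nonzero. *)
Lemma coupled_dominated (c : C) (al al' be : nat -> C) :
  (forall n, c + INR n <> 0) -> al O <> 0 ->
  abs_convergent2 (coupled c al be) -> dominated al' al ->
  abs_convergent2 (coupled c al' be).
Proof.
  intros Hc H0 H (K & M & HK & HD).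
  assert (B := coupled_base_summable c al be H0 H).
  assert (Rw : forall m, Csummable (fun n => be n / Cpochhammer c (m + n)))
    by (intros m; now apply coupled_row_summable).
  assert (Es : forall (g : nat -> C) m, Series (fun n => Cmod (coupled c g be m n))
    = (Cmod (g m) * Series (fun n => Cmod (be n / Cpochhammer c (m + n))))%R).
  { intros g m. rewrite <- Series_scal_l. apply Series_ext. intros n. apply Cmod_mult. }
  split; [intros m; exact (Csummable_scal (al' m) _ (Rw m))|].
  destruct H as [_ H]. apply (ex_series_shift M) in H. apply (ex_series_shift M).
  refine (ex_series_R_le _ _ _ (ex_series_scal K _ H)). intros m.
  change (scal K ?s) with (K * s)%R. rewrite !Es.
  set (S := Series _).
  assert (HS : (0 <= S)%R).
  { apply Rle_trans with (Cmod (be O / Cpochhammer c (m + M + 0))); [apply Cmod_ge_0|].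
    apply (term_le_Series (fun n => Cmod (be n / Cpochhammer c (m + M + n)))).
    - intros n. apply Cmod_ge_0.
    - apply Rw. }
  split; [apply Rmult_le_pos; [apply Cmod_ge_0 | exact HS]|].
  unfold scal; simpl; unfold mult; simpl. rewrite <- Rmult_assoc.
  apply Rmult_le_compat_r; [exact HS | apply HD; lia].
Qed.

(* The functions [fun q s => appell_shift a b t k x q s m] interpolate between
   the factor with parameter [b + r] (at q = r, s = 0) and the shifted factors
   on the right of the summation formula (at q = 0), along Pascal's triangle. *)
Definition appell_shift (a b t : C) (k : nat) (x : C) (q s m : nat) : C :=
  if Nat.ltb m s then 0 else
  Cpochhammer a m * discrete_pochhammer t k m * x ^ m
  * (Cpochhammer (b + INR s + INR q) (m - s) / INR (fact (m - s))).

Lemma appell_shift_lt (a b t : C) (k : nat) (x : C) (q s m : nat) :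
  (m < s)%nat -> appell_shift a b t k x q s m = 0.
Proof. intros H. unfold appell_shift. now rewrite (proj2 (Nat.ltb_lt m s) H). Qed.

Lemma appell_shift_add (a b t : C) (k : nat) (x : C) (q s j : nat) :
  appell_shift a b t k x q s (j + s) =
  Cpochhammer a (j + s) * discrete_pochhammer t k (j + s) * x ^ (j + s)
  * (Cpochhammer (b + INR s + INR q) j / INR (fact j)).
Proof.
  unfold appell_shift. rewrite (proj2 (Nat.ltb_ge (j + s) s)) by lia.
  now replace (j + s - s)%nat with j by lia.
Qed.

(** With j = m - s > 0 and beta = b + s + q this is (beta + 1)_j / j! = (beta)_j / j! + (beta +
    1)_(j-1) / (j - 1)!. For m = s the last term is absent, and for m < s everything is 0. *)
Lemma appell_shift_rec (a b t : C) (k : nat) (x : C) (q s m : nat) :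
  appell_shift a b t k x (S q) s m =
  appell_shift a b t k x q s m + appell_shift a b t k x q (S s) m.
Proof.
  destruct (Nat.lt_ge_cases m s) as [L|L].
  - rewrite !appell_shift_lt by lia. ring.
  - replace m with ((m - s) + s)%nat by lia. destruct (m - s)%nat as [|i].
    + rewrite !appell_shift_add, appell_shift_lt by lia. simpl. ring.
    + rewrite !appell_shift_add. replace (S i + s)%nat with (i + S s)%nat by lia.
      rewrite appell_shift_add.
      replace (b + INR s + INR (S q)) with (b + INR s + INR q + 1)
        by (rewrite INR_S_C; ring).
      replace (b + INR (S s) + INR q) with (b + INR s + INR q + 1)
        by (rewrite INR_S_C; ring).
      rewrite (Cpochhammer_S_l (b + INR s + INR q)), INR_fact_S_C. simpl Cpochhammer.
      field. split; [apply INR_fact_C_neq_0 | apply INR_S_C_neq_0].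
Qed.

(** From (b')_j (b' + j) = b' (b' + 1)_j, since |b' + j| >= 1 for large j. *)
Lemma appell_shift_dominated_up (a b t : C) (k : nat) (x : C) (q s : nat) :
  dominated (appell_shift a b t k x q s) (appell_shift a b t k x (S q) s).
Proof.
  set (b' := b + INR s + INR q).
  destruct (INR_unbounded_eventually (1 + Cmod b')) as [J HJ].
  exists (Cmod b'), (J + s)%nat. split; [apply Cmod_ge_0|]. intros m Hm.
  replace m with ((m - s) + s)%nat by lia. rewrite !appell_shift_add.
  set (j := (m - s)%nat). fold b'.
  replace (b + INR s + INR (S q)) with (b' + 1) by (unfold b'; rewrite INR_S_C; ring).
  rewrite !Cmod_mult, !Cmod_div by apply INR_fact_C_neq_0.
  set (U := (Cmod (Cpochhammer a (j + s)) * Cmod (discrete_pochhammer t k (j + s))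
             * Cmod (x ^ (j + s)))%R).
  assert (HU : (0 <= U)%R).
  { unfold U. apply Rmult_le_pos; [apply Rmult_le_pos|]; apply Cmod_ge_0. }
  assert (E : (Cmod (Cpochhammer b' j) * Cmod (b' + INR j)
               = Cmod b' * Cmod (Cpochhammer (b' + 1) j))%R).
  { rewrite <- !Cmod_mult, <- Cpochhammer_S_l. reflexivity. }
  assert (Hj : (1 <= Cmod (b' + INR j))%R).
  { pose proof (Cmod_plus_INR_ge b' j). specialize (HJ j ltac:(lia)). lra. }
  pose proof (Cmod_ge_0 (Cpochhammer b' j)).
  rewrite Cmod_INR. assert (Hf : (0 < / INR (fact j))%R)
    by apply Rinv_0_lt_compat, INR_fact_lt_0.
  unfold Rdiv. replace (Cmod b' * (U * (Cmod (Cpochhammer (b' + 1) j) * / INR (fact j))))%R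
    with (U * (Cmod b' * Cmod (Cpochhammer (b' + 1) j) * / INR (fact j)))%R by ring.
  apply Rmult_le_compat_l; [exact HU|]. apply Rmult_le_compat_r; [lra|]. nra.
Qed.

(** The two sides differ by the factor (j + 1) / (b' + j), of modulus at most 2 once j >= 1 + 2
    |b'|. *)
Lemma appell_shift_dominated_right (a b t : C) (k : nat) (x : C) (q s : nat) :
  dominated (appell_shift a b t k x q (S s)) (appell_shift a b t k x (S q) s).
Proof.
  set (b' := b + INR s + INR q + 1).
  destruct (INR_unbounded_eventually (1 + 2 * Cmod b')) as [J HJ].
  exists 2%R, (J + S s)%nat. split; [lra|]. intros m Hm.
  replace m with ((m - S s) + S s)%nat by lia. rewrite appell_shift_add.
  set (j := (m - S s)%nat). replace (j + S s)%nat with (S j + s)%nat by lia.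
  rewrite appell_shift_add.
  replace (b + INR s + INR (S q)) with b' by (unfold b'; rewrite INR_S_C; ring).
  replace (b + INR (S s) + INR q) with b' by (unfold b'; rewrite INR_S_C; ring).
  simpl Cpochhammer at 4. rewrite INR_fact_S_C, <- INR_S_C.
  rewrite !Cmod_mult, !Cmod_div, !Cmod_mult, !Cmod_INR by
    (try apply Cmult_neq_0; try apply INR_fact_C_neq_0;
     rewrite INR_S_C; apply INR_S_C_neq_0).
  set (U := (Cmod (Cpochhammer a (S j + s)) * Cmod (discrete_pochhammer t k (S j + s))
             * Cmod (x ^ (S j + s)))%R).
  assert (HU : (0 <= U)%R).
  { unfold U. apply Rmult_le_pos; [apply Rmult_le_pos|]; apply Cmod_ge_0. }
  assert (Hj : (INR (S j) <= 2 * Cmod (b' + INR j))%R).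
  { pose proof (Cmod_plus_INR_ge b' j). specialize (HJ j ltac:(lia)).
    rewrite S_INR. lra. }
  pose proof (Cmod_ge_0 (Cpochhammer b' j)) as PB.
  pose proof (INR_fact_lt_0 j) as Pf. pose proof (lt_0_INR (S j) (Nat.lt_0_succ j)) as PS.
  apply Rle_trans with (U * (Cmod (Cpochhammer b' j) / INR (fact j))
    * (2 * Cmod (b' + INR j) / INR (S j)))%R; [|right; field; lra].
  rewrite <- (Rmult_1_r (U * _)) at 1. apply Rmult_le_compat_l.
  - apply Rmult_le_pos; [exact HU|]. apply Rmult_le_pos; [exact PB|].
    left. now apply Rinv_0_lt_compat.
  - apply (Rmult_le_reg_r (INR (S j))); [exact PS|].
    unfold Rdiv. rewrite Rmult_assoc, Rinv_l by lra. lra.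
Qed.

(** Moves from (q, s) to (q + 1, s - 1) lead from (0, s) to (s, 0); raising q alone then reaches (r,
    0). *)
Lemma appell_shift_dominated (a b t : C) (k : nat) (x : C) (r s : nat) :
  (s <= r)%nat ->
  dominated (appell_shift a b t k x 0 s) (appell_shift a b t k x r 0).
Proof.
  intros H. apply dominated_trans with (appell_shift a b t k x s 0).
  - assert (F : forall s q, dominated (appell_shift a b t k x q s)
                              (appell_shift a b t k x (q + s) 0)).
    { clear. induction s as [|s IH]; intros q.
      - rewrite Nat.add_0_r. apply dominated_refl.
      - apply dominated_trans with (1 := appell_shift_dominated_right a b t k x q s).
        rewrite Nat.add_succ_r. exact (IH (S q)). }
    exact (F s O).
  - induction H as [|r H IH]; [apply dominated_refl|].
    exact (dominated_trans _ _ _ IH (appell_shift_dominated_up a b t k x r 0)).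
Qed.

Lemma appell_factor_shift (a b t : C) (k : nat) (x : C) (r m : nat) :
  appell_factor a (b + INR r) t k x m = appell_shift a b t k x r 0 m.
Proof.
  pose proof (appell_shift_add a b t k x r 0 m) as E.
  rewrite Nat.add_0_r in E. simpl in E. rewrite Cplus_0_r in E. now rewrite E.
Qed.

(* The first summation formula for an arbitrary sequence in place of the
   second factor. Where a shifted series diverges, its coefficient is zero. *)
Lemma coupled_summation (a b c t x : C) (k r : nat) (be : nat -> C) :
  (forall n, c + INR n <> 0) ->
  abs_convergent2 (coupled c (appell_factor a (b + INR r) t k x) be) ->
  let p s := Cpochhammer a s * discrete_pochhammer t k s / Cpochhammer c s in
  let w s := coupled (c + INR s)
    (appell_factor (a + INR s) (b + INR s) (t - INR (s * k)) k x) be in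
  (forall s, (s <= r)%nat -> p s * x ^ s = 0 \/ abs_convergent2 (w s)) /\
  CSeries2 (coupled c (appell_factor a (b + INR r) t k x) be) =
  sum_n (fun s => Binomial.C r s * p s * x ^ s * CSeries2 (w s)) r.
Proof.
  intros Hc H p w.
  pose (v := fun s => coupled c (appell_shift a b t k x 0 s) be).
  assert (V : forall s, (s <= r)%nat -> abs_convergent2 (v s)).
  { intros s Hs. apply (coupled_dominated c (appell_factor a (b + INR r) t k x));
      trivial; [apply appell_factor_0|].
    destruct (appell_shift_dominated a b t k x r s Hs) as (K & M & HK & HM).
    exists K, M. split; [exact HK|]. intros m Hm. rewrite appell_factor_shift. auto. }
  assert (VW : forall s m n, v s (m + s)%nat n = p s * x ^ s * w s m n).
  { intros s m n. unfold v, w, p, coupled, appell_factor. rewrite appell_shift_add.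
    replace (m + s + n)%nat with (s + (m + n))%nat by lia.
    rewrite (Nat.add_comm m s), discrete_pochhammer_add,
      (Cpochhammer_add c s), (Cpochhammer_add a s), Cpow_add_r.
    simpl. rewrite Cplus_0_r. field.
    repeat split; try apply INR_fact_C_neq_0; apply Cpochhammer_neq_0; trivial.
    intros i. rewrite <- Cplus_assoc, <- INR_plus_C. apply Hc. }
  assert (W : forall s, (s <= r)%nat -> p s * x ^ s = 0 \/ abs_convergent2 (w s)).
  { intros s Hs. destruct (Ceq_dec (p s * x ^ s) 0) as [E|E]; [now left | right].
    apply (abs_convergent2_ext (fun m n => / (p s * x ^ s) * v s (m + s)%nat n)).
    - intros m n. rewrite VW, Cmult_assoc, Cinv_l by exact E. apply Cmult_1_l.
    - apply abs_convergent2_scal, (abs_convergent2_shift s (v s)), V, Hs. }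
  split; [exact W|].
  transitivity (CSeries2 (fun m n => sum_n (fun s => Binomial.C r s * v s m n) r)).
  - apply CSeries2_ext. intros m n. unfold coupled. rewrite appell_factor_shift.
    rewrite (sum_n_binomial_recurrence r
      (fun q s => appell_shift a b t k x q s m)) by (intros; apply appell_shift_rec).
    rewrite <- (sum_n_mult_r (K := C_Ring)). apply sum_n_ext. intros s.
    change (@eq C (Binomial.C r s * appell_shift a b t k x 0 s m
      * (be n / Cpochhammer c (m + n))) (Binomial.C r s * v s m n)).
    unfold v, coupled. ring.
  - rewrite (proj2 (CSeries2_sum_n (fun s m n => Binomial.C r s * v s m n) r
      (fun s Hs => abs_convergent2_scal _ _ (V s Hs)))).
    apply sum_n_ext_loc. intros s Hs.
    change (@eq C (CSeries2 (fun m n => Binomial.C r s * v s m n))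
      (Binomial.C r s * p s * x ^ s * CSeries2 (w s))).
    rewrite CSeries2_scal by auto.
    rewrite (CSeries2_shift s) by
      (auto; intros m n Hm; unfold v, coupled; rewrite appell_shift_lt by exact Hm; ring).
    rewrite (CSeries2_ext _ _ (VW s)).
    (* With a zero coefficient both sides vanish, whatever unspecified value [CSeries2 (w s)]
       takes. *)
    destruct (W s Hs) as [E|E].
    + rewrite (CSeries2_ext _ (fun _ _ => 0)) by (intros; rewrite E; ring).
      rewrite <- (Cmult_assoc _ (p s)), E. unfold CSeries2.
      rewrite !CSeries_zero. ring.
    + rewrite CSeries2_scal by exact E. ring.
Qed.

(** * The first discrete Appell function *)

Lemma Cmod_Cpochhammer_ge (z : C) (k : nat) (B : R) :
  (1 <= B)%R -> (forall j, B <= Cmod (z + INR j))%R -> (1 <= k)%nat ->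
  (B <= Cmod (Cpochhammer z k))%R.
Proof.
  intros HB H Hk. induction Hk as [|k Hk IH]; simpl; rewrite Cmod_mult.
  - rewrite Cmod_1, Rmult_1_l. exact (H O).
  - specialize (H k). nra.
Qed.

(* For k > 0 the terms of the series with y = 0 eventually grow, unless they
   vanish. *)
Lemma appell_factor_not_small (a b t c x : C) (k : nat) :
  (1 <= k)%nat -> (forall n, c + INR n <> 0) ->
  (forall m, appell_factor a b t k x m <> 0) ->
  exists K, (0 <= K)%R /\
    forall m, (1 <= K * Cmod (appell_factor a b t k x m / Cpochhammer c m))%R.
Proof.
  intros Hk Hc H0.
  assert (Hx : (0 < Cmod x)%R).
  { apply Cmod_gt_0. intros E. apply (H0 1%nat). unfold appell_factor.
    rewrite E. simpl. ring. }
  assert (Ncm : forall m, Cpochhammer c m <> 0) by (intros; now apply Cpochhammer_neq_0).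
  assert (V0 : forall m, appell_factor a b t k x m / Cpochhammer c m <> 0).
  { intros m. apply Cmult_neq_0; [apply H0|].
    intros E. apply C1_nz. rewrite <- (Cinv_r _ (Ncm m)), E. ring. }
  pose (q := fun m => (a + INR m) * (b + INR m)
    * discrete_pochhammer (t - INR (m * k)) k 1 * x / ((c + INR m) * (INR m + 1))).
  assert (Eq : forall m, appell_factor a b t k x (S m) / Cpochhammer c (S m)
                         = q m * (appell_factor a b t k x m / Cpochhammer c m)).
  { intros m. unfold appell_factor, q.
    replace (discrete_pochhammer t k (S m))
      with (discrete_pochhammer t k m * discrete_pochhammer (t - INR (m * k)) k 1)
      by (rewrite <- discrete_pochhammer_add; f_equal; lia).
    rewrite INR_fact_S_C. simpl Cpochhammer. simpl Cpow. field.
    repeat split; auto using INR_S_C_neq_0, INR_fact_C_neq_0. }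
  destruct (ratio_bound unit (fun _ _ => 1%R)
    (fun _ m => Cmod (appell_factor a b t k x m / Cpochhammer c m))
    (fun _ _ => 1%R) (fun _ m => Cmod (q m))
    (/ Cmod (appell_factor a b t k x 0 / Cpochhammer c 0))%R) as (K & HK & HB).
  - left. now apply Rinv_0_lt_compat, Cmod_gt_0.
  - intros; lra.
  - intros; apply Cmod_ge_0.
  - intros; lra.
  - intros; apply Cmod_ge_0.
  - intros _. rewrite Rinv_l; [lra|]. specialize (V0 O). apply Cmod_gt_0 in V0. lra.
  - intros; lra.
  - intros _ m. now rewrite Eq, Cmod_mult.
  - intros m. assert (Q0 : q m <> 0).
    { intros E. apply (V0 (S m)). rewrite Eq, E. ring. }
    apply Cmod_gt_0 in Q0. exists (/ Cmod (q m))%R. split.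
    + left. now apply Rinv_0_lt_compat.
    + intros _. rewrite Rinv_l; lra.
  (* For m beyond this bound, the three large numerator factors are at least m / 2 and the two
     denominator factors at most 2 m, so |q m| >= m |x| / 32 >= 1. *)
  - destruct (INR_unbounded_eventually
      (2 * (1 + Cmod a + Cmod b + Cmod c + Cmod t) + 32 / Cmod x)) as [N HN].
    exists N. intros m _ Hm. specialize (HN m Hm).
    assert (Px : (0 < 32 / Cmod x)%R) by (apply Rdiv_lt_0_compat; lra).
    pose proof (Cmod_ge_0 a). pose proof (Cmod_ge_0 b). pose proof (Cmod_ge_0 c).
    pose proof (Cmod_ge_0 t).
    assert (Xm : (32 <= INR m * Cmod x)%R).
    { apply Rle_trans with (32 / Cmod x * Cmod x)%R; [right; field; lra|].
      apply Rmult_le_compat_r; lra. }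
    set (u := INR m) in *.
    assert (A1 : (u / 2 <= Cmod (a + u))%R)
      by (pose proof (Cmod_plus_INR_ge a m); fold u in H4; lra).
    assert (A2 : (u / 2 <= Cmod (b + u))%R)
      by (pose proof (Cmod_plus_INR_ge b m); fold u in H4; lra).
    assert (A3 : (Cmod (c + u) <= 2 * u)%R)
      by (pose proof (Cmod_plus_INR_le c m); fold u in H4; lra).
    assert (A4 : (u / 2 <= Cmod (discrete_pochhammer (t - INR (m * k)) k 1))%R).
    { unfold discrete_pochhammer. rewrite Nat.mul_1_l, Cmod_mult, Cmod_pow, Cmod_m1.
      rewrite pow1, Rmult_1_l. apply Cmod_Cpochhammer_ge; [lra| |exact Hk].
      intros j. replace (- (t - INR (m * k)) + INR j) with (- t + INR (m * k + j))
        by (rewrite INR_plus_C; ring).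
      pose proof (Cmod_plus_INR_ge (- t) (m * k + j)) as G. rewrite Cmod_opp in G.
      assert (u <= INR (m * k + j))%R by (apply le_INR; nia). lra. }
    assert (A5 : (0 < Cmod (c + u))%R) by apply Cmod_gt_0, Hc.
    unfold q. fold u. rewrite Cmod_div, !Cmod_mult by
      (apply Cmult_neq_0; [apply Hc | apply INR_S_C_neq_0]).
    replace (Cmod (u + 1)) with (u + 1)%R by
      (rewrite <- RtoC_plus, Cmod_R, Rabs_pos_eq; lra).
    apply (Rmult_le_reg_r (Cmod (c + u) * (u + 1))); [apply Rmult_lt_0_compat; lra|].
    unfold Rdiv. rewrite Rmult_1_l, Rmult_assoc, Rinv_l, Rmult_1_r by
      (apply Rmult_integral_contrapositive_currified; lra).
    apply Rle_trans with (2 * u * (2 * u))%R; [apply Rmult_le_compat; lra|].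
    apply Rle_trans with (u / 2 * (u / 2) * (u / 2) * Cmod x)%R; [nra|].
    apply Rmult_le_compat_r; [lra|].
    apply Rmult_le_compat; try lra; [nra|]. apply Rmult_le_compat; lra.
  - exists K. split; [exact HK|]. intros m. exact (HB tt m).
Qed.

Lemma factorially_small_finite (phi : nat -> C) (M : nat) :
  factorially_small (fun m => if Nat.leb m M then phi m else 0).
Proof.
  intros l Hl. pose (f := fun m => (Cmod (phi m) * INR (fact m))%R).
  assert (F0 : forall m, (0 <= f m)%R)
    by (intros m; apply Rmult_le_pos; [apply Cmod_ge_0 | apply pos_INR]).
  exists (sum_n f M). intros m. pose proof (sum_n_nonneg f M F0) as S0.
  pose proof (pow_R1_Rle l m ltac:(lra)) as P.
  destruct (Nat.leb_spec m M) as [L|L].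
  - pose proof (term_le_sum_n f M m F0 L). unfold f at 1 in H. nra.
  - rewrite Cmod_0. nra.
Qed.

(* The single series in m left after summation over n. *)
Definition inner_factor (b t c : C) (k : nat) (be : nat -> C) (m : nat) : C :=
  Cpochhammer b m * discrete_pochhammer t k m / INR (fact m)
  * CSeries (fun n => be n / Cpochhammer c (m + n)).

(** The rate l is split as s * s: one factor pays for (b)_m / m!, the other for m! times the inner
    sum. *)
Lemma inner_factor_small (b t c : C) (be : nat -> C) :
  (forall n, c + INR n <> 0) -> Csummable (fun n => be n / Cpochhammer c n) ->
  factorially_small (inner_factor b t c 0 be).
Proof.
  intros Hc Hbe l Hl. set (s := sqrt l).
  assert (Es : (s * s = l)%R) by (apply sqrt_sqrt; lra).
  assert (Hs : (1 < s)%R).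
  { unfold s. rewrite <- sqrt_1. apply sqrt_lt_1; lra. }
  destruct (Cpochhammer_upper b s Hs) as (L & HL & HLb).
  destruct (coupled_row_bound c be s Hc Hs) as (K & HK & HKb).
  set (S := Series (fun n => Cmod (be n / Cpochhammer c n))).
  exists (L * (K * S))%R. intros m. unfold inner_factor, discrete_pochhammer.
  rewrite Nat.mul_0_r. simpl Cpow. simpl (Cpochhammer (- t) 0).
  rewrite !Cmod_mult, Cmod_div, !Cmod_mult, Cmod_1, Cmod_INR by apply INR_fact_C_neq_0.
  pose proof (INR_fact_lt_0 m) as Pm. specialize (HLb m).
  assert (T : (Cmod (CSeries (fun n => be n / Cpochhammer c (m + n))%C) * INR (fact m)
               <= K * S * s ^ m)%R).
  { apply Rle_trans with (Series (fun n => Cmod (be n / Cpochhammer c (m + n))%C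
                                           * INR (fact m)))%R.
    - rewrite Series_scal_r. apply Rmult_le_compat_r; [lra|].
      now apply Cmod_CSeries, coupled_row_summable.
    - replace (K * S * s ^ m)%R with (K * s ^ m * S)%R by ring. unfold S.
      rewrite <- Series_scal_l. apply Series_le.
      + intros n. split; [|apply HKb].
        apply Rmult_le_pos; [apply Cmod_ge_0 | lra].
      + exact (ex_series_scal (K * s ^ m)%R _ Hbe). }
  rewrite <- Es, Rpow_mult_distr.
  apply Rle_trans with (L * s ^ m * (K * S * s ^ m))%R; [|right; ring].
  match goal with |- (?A * (?B * ?D) / ?E * ?F * ?G <= _)%R =>
    replace (A * (B * D) / E * F * G)%R with (A / E * (F * G))%R by (field; lra) end.
  apply Rmult_le_compat.
  - apply Rmult_le_pos; [apply Cmod_ge_0|]. left. now apply Rinv_0_lt_compat.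
  - apply Rmult_le_pos; [apply Cmod_ge_0 | lra].
  - apply (Rmult_le_reg_r (INR (fact m))); [exact Pm|].
    unfold Rdiv. rewrite Rmult_assoc, Rinv_l, Rmult_1_r by lra. lra.
  - exact T.
Qed.

(** For k > 0 some term must vanish, and phi is the truncation of the inner factor there. The
    vanishing may be due to (a)_M or to x, hence the presence of (a)_(r+m) and of powers of x in the
    identity. The free q lets the same phi serve x and x / (1 - z). *)
Lemma inner_factor_reduction (a b t c x : C) (k : nat) (be : nat -> C) :
  (forall n, c + INR n <> 0) -> be O <> 0 ->
  abs_convergent2 (coupled c (appell_factor a b t k x) be) ->
  exists phi, factorially_small phi /\ forall r m q,
    Cpochhammer a (r + m) * inner_factor b t c k be m * (x * q) ^ m =
    Cpochhammer a (r + m) * phi m * (x * q) ^ m.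
Proof.
  intros Hc Hbe H.
  destruct (Nat.eq_dec k 0) as [->|Hk].
  - exists (inner_factor b t c 0 be). split; [|reflexivity].
    apply inner_factor_small; [exact Hc|].
    exact (coupled_base_summable _ _ _ (appell_factor_0 a b t 0 x) H).
  - assert (Z : exists M, appell_factor a b t k x M = 0).
    { apply NNPP. intros Z.
      destruct (appell_factor_not_small a b t c x k ltac:(lia) Hc) as (K & HK & HB).
      { intros m E. apply Z. now exists m. }
      (* Column n = 0, divided by be_0, would tend to 0, against the lower bound [HB]. *)
      pose proof (abs_convergent2_row _ O (abs_convergent2_swap _ H)) as S.
      apply (Csummable_scal (/ be O)), ex_series_lim_0, is_lim_seq_spec in S.
      assert (K0 : (0 < K)%R).
      { specialize (HB O). destruct HK as [HK|<-]; [exact HK | lra]. }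
      destruct (S (mkposreal (/ K) (Rinv_0_lt_compat _ K0))) as [N HN].
      specialize (HN N (Nat.le_refl N)). specialize (HB N). simpl in HN.
      rewrite Rminus_0_r, Rabs_pos_eq in HN by apply Cmod_ge_0.
      unfold coupled in HN. rewrite Nat.add_0_r in HN.
      replace (/ be O * (appell_factor a b t k x N * (be O / Cpochhammer c N)))
        with (appell_factor a b t k x N / Cpochhammer c N) in HN
        by (field; split; [now apply Cpochhammer_neq_0 | exact Hbe]).
      apply (Rmult_lt_compat_l K) in HN; [|exact K0].
      rewrite Rinv_r in HN by lra. lra. }
    destruct Z as [M Z].
    exists (fun m => if Nat.leb m M then inner_factor b t c k be m else 0).
    split; [apply factorially_small_finite|]. intros r m q.
    destruct (Nat.leb_spec m M) as [L|L]; [reflexivity|].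
    assert (E : Cpochhammer a M = 0 \/ Cpochhammer b M = 0
                \/ discrete_pochhammer t k M = 0 \/ x = 0).
    { apply NNPP. intros E. apply not_or_and in E as [E1 E].
      apply not_or_and in E as [E2 E]. apply not_or_and in E as [E3 E4].
      assert (Nf : / INR (fact M) <> 0).
      { intros E. apply C1_nz. rewrite <- (Cinv_r _ (INR_fact_C_neq_0 M)), E. ring. }
      exact (Cmult_neq_0 _ _ (Cmult_neq_0 _ _ (Cmult_neq_0 _ _ E1 E3) (Cpow_nz x M E4))
        (Cmult_neq_0 _ _ E2 Nf) Z). }
    destruct E as [E|[E|[E|E]]].
    + rewrite (Cpochhammer_eq_0_le a M (r + m)) by (exact E || lia). ring.
    + unfold inner_factor. rewrite (Cpochhammer_eq_0_le b M m) by (exact E || lia).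
      unfold Cdiv. ring.
    + unfold inner_factor.
      rewrite (discrete_pochhammer_eq_0_le t k M m) by (exact E || lia).
      unfold Cdiv. ring.
    + rewrite E. destruct m as [|m]; [lia|]. simpl. ring.
Qed.

(** * The three summation formulas *)

Lemma F3_inner_factor (a1 a2 b1 b2 c t1 t2 : C) (k1 k2 : nat) (x y : C) :
  (forall n, c + INR n <> 0) ->
  Csummable (fun n => appell_factor a2 b2 t2 k2 y n / Cpochhammer c n) ->
  F3 a1 a2 b1 b2 c t1 t2 k1 k2 x y =
  CSeries (fun m => Cpochhammer a1 m
    * inner_factor b1 t1 c k1 (appell_factor a2 b2 t2 k2 y) m * x ^ m).
Proof.
  intros Hc H. apply CSeries_ext. intros m.
  etransitivity; [apply CSeries_ext; intros n; now apply F3_term_coupled|].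
  unfold coupled. rewrite CSeries_scal by now apply coupled_row_summable.
  unfold appell_factor at 1, inner_factor. field. apply INR_fact_C_neq_0.
Qed.

Lemma F3_summation_shift_a1 (a1 a2 b1 b2 c t1 t2 : C) (k1 k2 : nat) (x y z : C) :
  (forall n, c + INR n <> 0) -> (Cmod x < 1)%R -> (Cmod z < 1)%R ->
  (Cmod (x / (1 - z)) < 1)%R ->
  F3_convergent a1 a2 b1 b2 c t1 t2 k1 k2 x y ->
  let u := fun r : nat => Cpochhammer a1 r / INR (fact r) * z ^ r
    * F3 (a1 + INR r) a2 b1 b2 c t1 t2 k1 k2 x y in
  (Cmod x + Cmod z < 1)%R \/ ex_series u ->
  is_series u (one_minus_pow_opp z a1 * F3 a1 a2 b1 b2 c t1 t2 k1 k2 (x / (1 - z)) y).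
Proof.
  intros Hc Hx Hz Hxz Hconv u Hu.
  set (be := appell_factor a2 b2 t2 k2 y).
  assert (H : abs_convergent2 (coupled c (appell_factor a1 b1 t1 k1 x) be)).
  { revert Hconv. apply abs_convergent2_ext. intros m n. now apply F3_term_coupled. }
  assert (B := coupled_base_summable _ _ _ (appell_factor_0 a1 b1 t1 k1 x) H).
  destruct (inner_factor_reduction a1 b1 t1 c x k1 be Hc
    (appell_factor_0 a2 b2 t2 k2 y) H) as (phi & Hphi & E).
  assert (E1 : forall r m, Cpochhammer a1 (r + m) * inner_factor b1 t1 c k1 be m * x ^ m
                           = Cpochhammer a1 (r + m) * phi m * x ^ m).
  { intros r m. specialize (E r m 1). now rewrite Cmult_1_r in E. }
  assert (Eu : forall r, Mser a1 phi x r / INR (fact r) * z ^ r = u r).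
  { intros r. unfold u.
    rewrite F3_inner_factor by assumption. fold be.
    transitivity ((Cpochhammer a1 r * CSeries (fun m => Cpochhammer (a1 + INR r) m
      * inner_factor b1 t1 c k1 be m * x ^ m)) / INR (fact r) * z ^ r);
      [|unfold Cdiv; ring].
    (* If (a1)_r = 0, the series with parameter a1 + r may diverge, but it is multiplied by 0.
       Otherwise dividing the merged series by (a1)_r gives its sum. *)
    f_equal. f_equal. destruct (Ceq_dec (Cpochhammer a1 r) 0) as [Z|Z].
    - rewrite Z. unfold Mser. rewrite (CSeries_ext _ (fun _ => 0)).
      + rewrite CSeries_zero. ring.
      + intros m. rewrite Cpochhammer_add, Z. ring.
    - rewrite (CSeries_ext _ (fun m => / Cpochhammer a1 r
        * (Cpochhammer a1 (r + m) * phi m * x ^ m))).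
      + rewrite CSeries_scal by now apply Mser_summable.
        rewrite Cmult_assoc, Cinv_r by exact Z. symmetry. apply Cmult_1_l.
      + intros m. rewrite <- E1, Cpochhammer_add. field. exact Z. }
  apply (is_series_ext _ _ _ Eu).
  replace (F3 a1 a2 b1 b2 c t1 t2 k1 k2 (x / (1 - z)) y)
    with (Mser a1 phi (x / (1 - z)) 0).
  - apply Mser_summation; trivial. destruct Hu as [Hu|Hu]; [now left | right].
    revert Hu. apply ex_series_ext. intros r. symmetry. apply Eu.
  - rewrite F3_inner_factor by assumption. apply CSeries_ext. intros m.
    symmetry. exact (E O m (/ (1 - z))).
Qed.

Lemma F3_summation_shift_b1 (a1 a2 b1 b2 c t1 t2 : C) (k1 k2 : nat) (x y : C) (r : nat) :
  (forall n, c + INR n <> 0) ->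
  F3_convergent a1 a2 (b1 + INR r) b2 c t1 t2 k1 k2 x y ->
  F3 a1 a2 (b1 + INR r) b2 c t1 t2 k1 k2 x y =
  sum_n (fun s : nat =>
    Binomial.C r s
    * (Cpochhammer a1 s * ((-(1)) ^ (s * k1) * Cpochhammer (- t1) (s * k1))
       / Cpochhammer c s)
    * x ^ s
    * F3 (a1 + INR s) a2 (b1 + INR s) b2 (c + INR s)
         (t1 - INR (s * k1)) t2 k1 k2 x y) r.
Proof.
  intros Hc H.
  assert (Hcs : forall s n, c + INR s + INR n <> 0).
  { intros s n. rewrite <- Cplus_assoc, <- INR_plus_C. apply Hc. }
  apply (abs_convergent2_ext _ _ (fun m n => F3_term_coupled _ _ _ _ _ _ _ _ _ _ _ m n Hc))
    in H.
  unfold F3 at 1.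
  rewrite (CSeries2_ext _ _ (fun m n => F3_term_coupled _ _ _ _ _ _ _ _ _ _ _ m n Hc)).
  etransitivity; [exact (proj2 (coupled_summation _ _ _ _ _ _ _ _ Hc H))|].
  apply sum_n_ext. intros s. f_equal. apply CSeries2_ext. intros m n.
  symmetry. now apply F3_term_coupled.
Qed.

(** [F3] is summed with n innermost, so the exchanged roles must be undone in every term on the
    right. This needs its absolute convergence or a zero coefficient, which is the first conclusion
    of [coupled_summation]. *)
Lemma F3_summation_shift_b2 (a1 a2 b1 b2 c t1 t2 : C) (k1 k2 : nat) (x y : C) (r : nat) :
  (forall n, c + INR n <> 0) ->
  F3_convergent a1 a2 b1 (b2 + INR r) c t1 t2 k1 k2 x y ->
  F3 a1 a2 b1 (b2 + INR r) c t1 t2 k1 k2 x y =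
  sum_n (fun s : nat =>
    Binomial.C r s
    * (Cpochhammer a2 s * ((-(1)) ^ (s * k2) * Cpochhammer (- t2) (s * k2))
       / Cpochhammer c s)
    * y ^ s
    * F3 a1 (a2 + INR s) b1 (b2 + INR s) (c + INR s)
         t1 (t2 - INR (s * k2)) k1 k2 x y) r.
Proof.
  intros Hc H.
  assert (Hcs : forall s n, c + INR s + INR n <> 0).
  { intros s n. rewrite <- Cplus_assoc, <- INR_plus_C. apply Hc. }
  assert (Ec : forall c, (forall n, c + INR n <> 0) -> forall a2 b2 t2 m n,
    F3_term a1 a2 b1 b2 c t1 t2 k1 k2 x y m n =
    coupled c (appell_factor a2 b2 t2 k2 y) (appell_factor a1 b1 t1 k1 x) n m).
  { intros c' Hc' a2' b2' t2' m n. rewrite coupled_comm. now apply F3_term_coupled. }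
  unfold F3 at 1. rewrite (CSeries2_swap _ H).
  apply abs_convergent2_swap in H.
  apply (abs_convergent2_ext _ _ (fun n m => Ec c Hc a2 (b2 + INR r) t2 m n)) in H.
  rewrite (CSeries2_ext _ _ (fun n m => Ec c Hc a2 (b2 + INR r) t2 m n)).
  destruct (coupled_summation _ _ _ _ _ _ _ _ Hc H) as [W E].
  etransitivity; [exact E|].
  apply sum_n_ext_loc. intros s Hs. unfold F3.
  rewrite (CSeries2_ext (F3_term _ _ _ _ _ _ _ _ _ _ _)
    _ (Ec (c + INR s) (Hcs s) (a2 + INR s) (b2 + INR s) (t2 - INR (s * k2)))).
  destruct (W s Hs) as [Z|V].
  - apply (f_equal (Cmult (Binomial.C r s))) in Z.
    rewrite Cmult_0_r, Cmult_assoc in Z. unfold discrete_pochhammer in *.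
    now rewrite Z, !Cmult_0_l.
  - f_equal. exact (CSeries2_swap _ V).
Qed.

Theorem theorem4p1 (a1 a2 b1 b2 c t1 t2 : C) (k1 k2 : nat) (x y : C)
  (hc : forall n : nat, Re c <> (- INR n)%R)
  (hx : (Cmod x < 1)%R) (hy : (Cmod y < 1)%R) :
  (forall r : nat,
     F3_convergent a1 a2 (b1 + INR r) b2 c t1 t2 k1 k2 x y ->
     F3 a1 a2 (b1 + INR r) b2 c t1 t2 k1 k2 x y =
     sum_n (fun s : nat =>
       Binomial.C r s
       * (Cpochhammer a1 s * ((-(1)) ^ (s * k1) * Cpochhammer (- t1) (s * k1))
          / Cpochhammer c s)
       * x ^ s
       * F3 (a1 + INR s) a2 (b1 + INR s) b2 (c + INR s)
            (t1 - INR (s * k1)) t2 k1 k2 x y) r)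
  /\
  (forall r : nat,
     F3_convergent a1 a2 b1 (b2 + INR r) c t1 t2 k1 k2 x y ->
     F3 a1 a2 b1 (b2 + INR r) c t1 t2 k1 k2 x y =
     sum_n (fun s : nat =>
       Binomial.C r s
       * (Cpochhammer a2 s * ((-(1)) ^ (s * k2) * Cpochhammer (- t2) (s * k2))
          / Cpochhammer c s)
       * y ^ s
       * F3 a1 (a2 + INR s) b1 (b2 + INR s) (c + INR s)
            t1 (t2 - INR (s * k2)) k1 k2 x y) r)
  /\
  (forall z : C,
     (Cmod z < 1)%R -> (Cmod (x / (1 - z)) < 1)%R ->
     F3_convergent a1 a2 b1 b2 c t1 t2 k1 k2 x y ->
     let u := fun r : nat =>
       Cpochhammer a1 r / INR (fact r) * z ^ r
       * F3 (a1 + INR r) a2 b1 b2 c t1 t2 k1 k2 x y in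
     (Cmod x + Cmod z < 1)%R \/ ex_series u ->
     is_series u
       (one_minus_pow_opp z a1
        * F3 a1 a2 b1 b2 c t1 t2 k1 k2 (x / (1 - z)) y)).
Proof.
  assert (Hc : forall n, c + INR n <> 0).
  { intros n E. apply (hc n). apply (f_equal Re) in E.
    change (Re c + INR n = 0)%R in E. lra. }
  repeat split.
  - intros r. now apply F3_summation_shift_b1.
  - intros r. now apply F3_summation_shift_b2.
  - intros z. now apply F3_summation_shift_a1.
Qed.
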